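(* Let $K>2$, let $\lambda_1,\dots,\lambda_K>0$ be arrival rates and $p_1>p_2>\cdots>p_K>0$ prices, and let $\boldsymbol\beta=(\beta_1,\dots,\beta_{K-1})$ satisfy $\sum_{i=1}^{j}\lambda_i<\beta_j<\sum_{i=1}^{j+1}\lambda_i$ for each $j\in\{1,\dots,K-1\}$. Then the $\boldsymbol\beta$-LT policy has uniformly bounded regret: there exists a finite constant $C$, not depending on $n$ or $T$, such that for every initial inventory $n\in\mathbb{N}$ and every horizon length $T>0$ the regret of the $\boldsymbol\beta$-LT policy is at most $C$.
   Context: Time $t$ denotes the time remaining, so it runs downward from $t=T$ (start) to $t=0$ (end). Customers of classes $1,\dots,K$ arrive according to independent Poisson processes with rates $\lambda_1,\dots,\lambda_K$; each requests one unit, and a class-$j$ customer pays $p_j$ if accepted. $N_{j,T}(t)$ is the number of class-$j$ arrivals from the start (time $T$) until the moment when $t$ time units remain. The retailer starts with $n$ units, with no replenishment and no salvage value. Each customer is immediately and irrevocably accepted (using one unit) or rejected; all customers are rejected once inventory is $0$ (so ''always accepted'' below means while inventory is positive). ''The sample path'' is the inventory position as a function of $t$ (once inventory is depleted, it is continued to negative values by continuing to subtract arrivals of the classes that are always accepted). ''At or above the $\beta_j$-line at time $t$'' means inventory (just before the decision) at least $\beta_j t$. The $\boldsymbol\beta$-LT policy depends on $\alpha=n/T$: (1) If $\alpha\in[\beta_{k-1},\beta_k]$ for some $k\in\{2,\dots,K-1\}$: accept all customers of classes $1,\dots,k$ and no others until the stopping time $S=\max\{t\le T: n-\sum_{j=1}^{k}N_{j,T}(t)\notin(\beta_{k-1}t,\beta_kt)\}$.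 If $n-\sum_{j=1}^kN_{j,T}(S)\le\beta_{k-1}S$, then for all $t<S$: classes $1,\dots,k-1$ are always accepted, class $k$ is accepted iff the sample path is at or above the $\beta_{k-1}$-line, and classes $k+1,\dots,K$ are never accepted. If instead $n-\sum_{j=1}^kN_{j,T}(S)\ge\beta_kS$, then for all $t<S$: classes $1,\dots,k$ are always accepted, class $k+1$ is accepted iff the sample path is at or above the $\beta_k$-line, and classes $k+2,\dots,K$ are never accepted. (2) If $\alpha<\beta_1$: accept only class-1 customers until the sample path intersects the $\beta_1$-line; from then on class 1 is always accepted, class 2 is accepted iff the sample path is at or above the $\beta_1$-line, and all other classes are never accepted. (3) If $\alpha>\beta_{K-1}$: accept all customers until the sample path first crosses or intersects the $\beta_{K-1}$-line; from then on class-$K$ customers are rejected iff the sample path is below the $\beta_{K-1}$-line, and all other customers are always accepted. The hindsight-optimal revenue for a realization is the maximum revenue obtainable by choosing at most $n$ of the customers who arrive over the whole horizon (i.e. serving the highest-priced arrivals first). The regret of the policy for given $n,T$ is the expected value of the hindsight-optimal revenue minus the policy's revenue. *)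

(* Defs.v *)
(* MathComp-Analysis. *)
From HB Require Import structures.
From mathcomp Require Import all_boot all_order all_algebra.
From mathcomp Require Import all_classical all_reals all_analysis.

Set Implicit Arguments.
Unset Strict Implicit.
Unset Printing Implicit Defensive.

Import Order.TTheory GRing.Theory Num.Theory.
Import numFieldNormedType.Exports.

Local Open Scope classical_set_scope.
Local Open Scope ring_scope.

Section PoissonProcesses.
Context {d : measure_display} {Omega : measurableType d} {R : realType}.
Variable P : probability Omega R.

(* Mutual independence of finitely many set systems, each of which is meant to
   contain [setT]; the product rule for subfamilies then follows by taking
   [E i = setT] outside the subfamily. *)
Definition independent_systems (I : finType) (G : I -> set_system Omega) :=
  forall E : I -> set Omega, (forall i, G i (E i)) ->
    P (\bigcap_i E i) = (\prod_(i : I) P (E i))%E.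

(* A homogeneous Poisson counting process; only the times [s >= 0] matter. *)
Record poisson_process (rate : R) (N : R -> Omega -> nat) : Prop := {
  poisson_measurable : forall s, 0 <= s -> measurable_fun setT (N s) ;
  poisson_start : forall w, N 0 w = 0%N ;
  poisson_nondecreasing : forall w s t,
    0 <= s -> s <= t -> (N s w <= N t w)%N ;
  poisson_right_continuous : forall w s, 0 <= s -> N ^~ w @ s^'+ --> N s w ;
  poisson_independent_increments : forall (m : nat) (s : nat -> R),
    0 <= s 0%N -> (forall i, (i < m)%N -> s i <= s i.+1) ->
    independent_systems (fun i : 'I_m =>
      preimage_set_system setT (fun w => (N (s i.+1) w - N (s i) w)%N)
        measurable) ;
  (* [s < t] is strict because the library sets [poisson_pmf 0 k = 1] *)
  poisson_increment_law : forall s t k, 0 <= s -> s < t ->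
    P [set w | (N t w - N s w)%N = k] = (poisson_pmf (rate * (t - s)) k)%:E }.

Definition process_sigma_algebra (N : R -> Omega -> nat) : set_system Omega :=
  <<s \bigcup_(s in [set s : R | 0 <= s])
        preimage_set_system setT (N s) measurable >>.

(* Classes are numbered 1, ..., K; other indices are irrelevant. *)
Definition independent_poisson_arrivals (K : nat) (lambda : nat -> R)
    (A : nat -> R -> Omega -> nat) : Prop :=
  (forall j, (1 <= j <= K)%N -> poisson_process (lambda j) (A j)) /\
  independent_systems (fun i : 'I_K => process_sigma_algebra (A i.+1)).

End PoissonProcesses.

(* One realization: [A j s] is the number of class-[j] arrivals during the first
   [s] time units, whereas policies are written in
   terms of the time [t] remaining, N_{j,T}(t) being [A j (T - t)]. *)
Section Realization.
Context {R : realType}.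
Variables (K : nat) (p beta : nat -> R) (n : nat) (T : R) (A : nat -> R -> nat).

Definition arrivals_until (j : nat) (t : R) : nat := A j (T - t).

(* elapsed time at which the [i]-th class-[j] customer arrives, [i >= 1] *)
Definition arrival_time (j i : nat) : R :=
  inf [set s : R | 0 <= s /\ (i <= A j s)%N].

(* all customers of the horizon, as (elapsed time, class), in order of arrival;
   simultaneous arrivals have probability zero *)
Definition customers : seq (R * nat) :=
  sort (fun a b => a.1 <= b.1)
    [seq (arrival_time j i, j) | j <- iota 1 K, i <- iota 1 (A j T)].

Definition hindsight_revenue : R :=
  let class i := nth 0%N [seq a.2 | a <- customers] i in
  \big[Num.max/0]_(S : {set 'I_(size customers)} | (#|S| <= n)%N)
    \sum_(i in S) p (class i).

(* inventory with [t] time units left when exactly classes 1, ..., k have been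
   accepted so far *)
Definition nested_path (k : nat) (t : R) : R :=
  n%:R - \sum_(1 <= j < k.+1) (arrivals_until j t)%:R.

(* always accept classes 1, ..., k; accept class k+1 iff the sample path is at
   or above the beta_k-line; reject all other classes *)
Definition threshold_rule (k : nat) (t : R) (j : nat) (x : int) : bool :=
  (j <= k)%N || ((j == k.+1) && (beta k * t <= x%:~R)).

(* The stopping times below are the largest remaining times at which the path
   meets the stated condition: the sets contain their supremum, as paths are
   right-continuous in elapsed time. If a set is empty, [sup] is 0, so that the
   initial rule is used throughout. *)
Definition stop_middle (k : nat) : R :=
  sup [set t : R | 0 <= t <= T /\
        ~ (beta k.-1 * t < nested_path k t < beta k * t)].

Definition stop_low : R :=
  sup [set t : R | 0 <= t <= T /\ nested_path 1 t = beta 1%N * t].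

Definition stop_high : R :=
  sup [set t : R | 0 <= t <= T /\ nested_path K t <= beta K.-1 * t].

(* Does the policy accept a class-[j] customer arriving with [t] time units left,
   the sample path just before the arrival being [x]? If alpha equals
   some beta_k with 1 < k < K-1, two values of [k] qualify in the last
   case, and both give [threshold_rule k] from the start. *)
Definition LT_accepts (t : R) (j : nat) (x : int) : bool :=
  let alpha := n%:R / T in
  if alpha < beta 1%N then
    if t < stop_low then threshold_rule 1 t j x else j == 1%N
  else if beta K.-1 < alpha then
    if t < stop_high then threshold_rule K.-1 t j x else true
  else if [pick k : 'I_K | (1 < k)%N && (beta k.-1 <= alpha <= beta k)]
       is Some k then
    if t < stop_middle k then
      if nested_path k (stop_middle k) <= beta k.-1 * stop_middle k
      then threshold_rule k.-1 t j x
      else threshold_rule k t j x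
    else (j <= k)%N
  else false.

(* Revenue from the remaining customers [l], the sample path being [x]. The path
   may become negative, but a customer is served only if [0 < x]. *)
Fixpoint LT_revenue_from (l : seq (R * nat)) (x : int) : R :=
  if l is (s, j) :: l' then
    if LT_accepts (T - s) j x
    then (if 0 < x then p j else 0) + LT_revenue_from l' (x - 1)
    else LT_revenue_from l' x
  else 0.

Definition LT_revenue : R := LT_revenue_from customers n%:Z.

End Realization.

Definition LT_regret {d : measure_display} {Omega : measurableType d}
    {R : realType} (P : probability Omega R) (K : nat) (p beta : nat -> R)
    (A : nat -> R -> Omega -> nat) (n : nat) (T : R) : \bar R :=
  ('E_P[fun w => (hindsight_revenue K p n T (fun j s => A j s w)
                  - LT_revenue K p beta n T (fun j s => A j s w))%R])%E.

(* Main.v *)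
(** Pathwise, let F be the inventory at the end when it is continued below 0.
    The policy always accepts all classes up to some k and accepts no class above
    k+1, so comparing every price with q = p_(k+1) bounds the regret by
    q F + p_1 max(-F, 0) <= p_1 |F|.  After the stopping time the path
    is pulled towards the beta_k-line.  Going back to the last time it was on the
    wrong side of the line gives
      F <= sup_s (beta_k (T - s) - arrivals of classes <= k+1 during (s, T]),
      -F <= 1 + jump + sup_s (arrivals of classes <= k during [s, T] - beta_k (T - s)),
    where "jump" bounds the overshoot at the stopping time; no strong Markov
    property is needed.  As beta_k lies strictly between the two total rates,
    both suprema have means bounded uniformly in T.  The line's slope is shared
    among the classes in proportion to their rates and a union bound with
    exponential moments is taken over integer times, so only the increment laws
    are used, not independence.  If the low (high) inventory path never meets its
    line, then F <= 0 with q = p_1 (F >= 0 with q = 0) and the regret is 0. *)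

Require Import Defs.
From HB Require Import structures.
From mathcomp Require Import all_boot all_order all_algebra.
From mathcomp Require Import all_classical all_reals all_analysis.
From mathcomp Require Import measurable_realfun.
From mathcomp Require Import ring lra.

Set Implicit Arguments.
Unset Strict Implicit.
Unset Printing Implicit Defensive.

Import Order.TTheory GRing.Theory Num.Theory.

Local Open Scope classical_set_scope.
Local Open Scope ring_scope.

(** * Means of dominated variables and Poisson exponential moments *)

Lemma poisson_generating_series (R : realType) (mu z : R) : 0 < mu -> 0 <= z ->
  (\sum_(k <oo) (z ^+ k * poisson_pmf mu k)%:E = (expR (mu * (z - 1)))%:E)%E.
Proof.
move=> mu0 z0.
have -> : mu * (z - 1) = - mu + z * mu by ring.
rewrite expRD EFinM.
under eq_eseriesr.
  move=> k _; rewrite /poisson_pmf mu0.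
  have -> : z ^+ k * (mu ^+ k / k`!%:R * expR (- mu)) =
            expR (- mu) * exp_coeff (z * mu) k.
    by rewrite /exp_coeff /= exprMn; ring.
  rewrite EFinM; over.
rewrite /= nneseriesZl/=; last first.
  by move=> k _; rewrite lee_fin divr_ge0// exprn_ge0// mulr_ge0// ltW.
congr *%E; rewrite /expR -EFin_lim; last exact: is_cvg_series_exp_coeff.
by apply/congr_lim/funext => k/=; rewrite /series/= -sumEFin.
Qed.

Section MeanBound.
Context {d : measure_display} {Omega : measurableType d} {R : realType}.
Variable P : probability Omega R.

(** Bundling measurability and nonnegativity with the bound lets dominating variables be added and
    scaled with no integrability side conditions. *)
Definition mean_le (f : Omega -> R) (c : R) : Prop :=
  [/\ measurable_fun setT f, forall w, 0 <= f w &
      (\int[P]_w (f w)%:E <= c%:E)%E].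

Lemma integral_const (c : R) : (\int[P]_w c%:E = c%:E)%E.
Proof.
rewrite integral_cst//; have /= -> := probability_setT P; exact: mule1.
Qed.

Lemma mean_le_cst (c : R) : 0 <= c -> mean_le (fun=> c) c.
Proof.
move=> c0; split => //.
by rewrite integral_const.
Qed.

Lemma mean_leD f g a b : mean_le f a -> mean_le g b ->
  mean_le (fun w => f w + g w) (a + b).
Proof.
move=> [mf f0 fa] [mg g0 gb]; split.
- exact: measurable_funD.
- by move=> w; rewrite addr_ge0.
- under eq_integral do rewrite EFinD.
  rewrite ge0_integralD//; first by rewrite EFinD leeD.
  + by move=> w _; rewrite lee_fin.
  + exact/measurable_EFinP.
  + by move=> w _; rewrite lee_fin.
  + exact/measurable_EFinP.
Qed.

Lemma mean_leZ k f a : 0 <= k -> mean_le f a -> mean_le (fun w => k * f w) (k * a).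
Proof.
move=> k0 [mf f0 fa]; split.
- exact: measurable_funM.
- by move=> w; rewrite mulr_ge0.
- under eq_integral do rewrite EFinM.
  rewrite ge0_integralZl_EFin//; first by rewrite EFinM lee_wpmul2l.
  + by move=> w _; rewrite lee_fin.
  + exact/measurable_EFinP.
Qed.

Lemma mean_le_sum (I : eqType) (r : seq I) (f : I -> Omega -> R) (c : I -> R) :
  (forall i, i \in r -> mean_le (f i) (c i)) ->
  mean_le (fun w => \sum_(i <- r) f i w) (\sum_(i <- r) c i).
Proof.
elim: r => [|i r IHr] h.
  rewrite big_nil; under [fun _ => _]funext do rewrite big_nil.
  exact: mean_le_cst.
rewrite big_cons; under [fun _ => _]funext do rewrite big_cons.
apply: mean_leD; first by apply: h; rewrite mem_head.
by apply: IHr => j jr; apply: h; rewrite inE jr orbT.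
Qed.

Lemma mean_le_weaken f a b : a <= b -> mean_le f a -> mean_le f b.
Proof.
move=> ab [mf f0 fa]; split => //; apply: le_trans fa _; by rewrite lee_fin.
Qed.

(* [X] is arbitrary, possibly non-measurable: the library's integral of a
   nonnegative function is a supremum over the simple functions below it. *)
Lemma expectation_le_dominated (X f : Omega -> R) (c : R) :
  mean_le f c -> (forall w, X w <= f w) -> ('E_P[X] <= c%:E)%E.
Proof.
move=> [mf f0 fc] Xf; rewrite unlock; apply: le_trans fc.
rewrite [leRHS]ge0_integralTE; last by move=> w; rewrite lee_fin.
rewrite /integral /= !patch_setT.
rewrite -[leRHS]sube0; apply: leeB.
  apply: ereal_sup_le => _ [h hle <-]; exists h => // w.
  apply: le_trans (hle w) _; rewrite funeposE maxEge.
  by case: ifPn => _; rewrite lee_fin.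
apply: ereal_sup_ubound; exists (@nnsfun0 _ Omega R); last exact: sintegral0.
by move=> w; rewrite funenegE le_max lexx orbT.
Qed.

(** Splitting the integral over the level sets of the increment turns it into the Poisson generating
    series. Values [z < 1] serve the lower-tail estimate, values [z > 1] the upper-tail one and the
    cell bound. *)
Lemma mean_le_poisson (rate : R) (N : R -> Omega -> nat) (z s t : R) :
  poisson_process P rate N -> 0 < rate -> 0 <= z -> 0 <= s -> s <= t ->
  mean_le (fun w => z ^+ (N t w - N s w)) (expR (rate * (t - s) * (z - 1))).
Proof.
move=> HN r0 z0 s0 st.
have mX : measurable_fun setT (fun w => (N t w - N s w)%N).
  apply: measurable_fun_subn; apply: (poisson_measurable HN) => //.
  exact: le_trans st.
have mf : measurable_fun setT (fun w => z ^+ (N t w - N s w)).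
  exact: (measurableT_comp (f := fun k : nat => z ^+ k)).
split => //; first by move=> w; rewrite exprn_ge0.
(* The increment law covers only [s < t]; for [s = t] both sides are 1. *)
move: st; rewrite le_eqVlt => /predU1P[<-|st].
  under eq_integral do rewrite subnn expr0.
  by rewrite integral_const subrr mulr0 mul0r expR0.
rewrite le_eqVlt; apply/orP; left; apply/eqP.
pose F k := [set w | (N t w - N s w)%N = k].
have mF k : measurable (F k).
  have := mX measurableT [set k]; rewrite setTI; exact.
have UF : setT = \bigcup_k F k.
  by apply/seteqP; split => // w _; exists (N t w - N s w)%N.
rewrite [in LHS]UF ge0_integral_bigcup//; last first.
- apply/trivIsetP => i j _ _ /eqP ij; rewrite -subset0 => w [wi wj]; apply: ij.
  exact: etrans (esym (wi : _ = i)) wj.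
- by move=> w _; rewrite lee_fin exprn_ge0.
- by rewrite -UF; exact/measurable_EFinP.
rewrite -poisson_generating_series// ?mulr_gt0 ?subr_gt0//.
apply: eq_eseriesr => k _.
rewrite (_ : \int[P]_(w in F k) _ = \int[P]_(w in F k) (z ^+ k)%:E)%E; last first.
  by apply: eq_integral => w /set_mem wF; rewrite (wF : _ = k).
rewrite integral_cst//; have /= -> := poisson_increment_law HN k s0 st; by rewrite EFinM.
Qed.

End MeanBound.

(** * Uniform bounds for one Poisson process *)

(** As a function of [eta] the second expression vanishes at 0 with slope [b - lam], so it is
    negative for small [eta] of the sign of [lam - b]. The explicit choice works through
    [expR (- eta) <= (1 + eta)^-1]. *)
Lemma cramer_exponent (R : realType) (lam b : R) : 0 < lam -> 0 < b -> b != lam ->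
  exists2 eta, 0 < eta * (lam - b) & eta * b + lam * (expR (- eta) - 1) < 0.
Proof.
move=> l0 b0 bl; pose eta := (lam - b) / (2 * b).
have b1 : 1 + eta = (lam + b) / (2 * b) by rewrite /eta; field; lra.
have e1 : 0 < 1 + eta by rewrite b1 divr_gt0//; lra.
exists eta.
  have -> : eta * (lam - b) = (lam - b) ^+ 2 / (2 * b) by rewrite /eta; field; lra.
  rewrite divr_gt0//; last by lra.
  by rewrite lt_def sqr_ge0 andbT sqrf_eq0 subr_eq0 eq_sym.
apply: (@le_lt_trans _ _ (eta * b + lam * ((1 + eta)^-1 - 1))).
  rewrite lerD2l ler_pM2l// lerD2r expRN lef_pV2 ?posrE ?expR_gt0//.
  exact: expR_ge1Dx.
have -> : eta * b + lam * ((1 + eta)^-1 - 1) = - ((lam - b) ^+ 2 / (2 * (lam + b))).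
  by rewrite b1 /eta; field; lra.
rewrite oppr_lt0 divr_gt0//; last by lra.
by rewrite lt_def sqr_ge0 andbT sqrf_eq0 subr_eq0 eq_sym.
Qed.

Lemma le_expR_div (R : realType) (e x : R) : 0 < e -> x <= e^-1 * expR (e * x).
Proof.
move=> e0; rewrite mulrC ler_pdivlMr// mulrC.
by apply: le_trans (expR_ge1Dx _); rewrite lerDr.
Qed.

Lemma geometric_sum_le (R : realType) (rho : R) (m : nat) : 0 <= rho < 1 ->
  \sum_(i <- iota 0 m) rho ^+ i <= (1 - rho)^-1.
Proof.
move=> /andP[r0 r1].
have -> : \sum_(i <- iota 0 m) rho ^+ i = \sum_(i < m) rho ^+ i.
  by rewrite -[m in iota 0 m]subn0 -/(index_iota 0 m) big_mkord.
rewrite -[leRHS]mul1r ler_pdivlMr ?subr_gt0// mulrC.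
have := subrX1 rho m; have := exprn_ge0 m r0; lra.
Qed.

(** Rounding the remaining time down to an integer [i] costs at most [b]. The maximum over [i] of
    the rounded deficits is at most the sum of their exponentials divided by [eta], and the [i]-th
    exponential has mean [rho ^+ i], a geometric series bounded independently of [T]. *)
Lemma poisson_deficit (R : realType) (lam b : R) : 0 < b -> b < lam ->
  exists C : R, forall (d : measure_display) (Omega : measurableType d)
    (P : probability Omega R) (N : R -> Omega -> nat),
    poisson_process P lam N -> forall T : R, 0 < T ->
    exists2 f, mean_le P f C & forall w (s : R), 0 <= s <= T ->
      b * (T - s) - ((N T w)%:R - (N s w)%:R) <= f w.
Proof.
move=> b0 bl; have l0 : 0 < lam by exact: lt_trans bl.
have bnl : b != lam by rewrite lt_eqF.
have [eta se he] := cramer_exponent l0 b0 bnl.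
have e0 : 0 < eta by move: se; rewrite pmulr_lgt0// subr_gt0.
set z := expR (- eta) in he *.
set rho := expR (eta * b + lam * (z - 1)).
have r1 : 0 <= rho < 1 by rewrite expR_ge0 expR_lt1.
exists (b + eta^-1 * (1 - rho)^-1) => d Omega P N HN T T0.
exists (fun w => b + eta^-1 * \sum_(i <- iota 0 (Num.truncn T).+1)
   (expR (eta * b) ^+ i * z ^+ (N T w - N (T - i%:R) w))).
  apply: mean_leD; first by apply: mean_le_cst; exact: ltW.
  apply: mean_leZ; first by rewrite invr_ge0 ltW.
  apply: (mean_le_weaken (geometric_sum_le (Num.truncn T).+1 r1)).
  apply: mean_le_sum => i; rewrite mem_iota add0n /= ltnS => iT.
  have iT' : i%:R <= T by rewrite -truncn_ge_nat// ltW.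
  have -> : rho ^+ i = expR (eta * b) ^+ i * expR (lam * (T - (T - i%:R)) * (z - 1)).
    rewrite -!expRM_natl -expRD; congr expR; ring.
  apply: mean_leZ; first by rewrite exprn_ge0// expR_ge0.
  by apply: mean_le_poisson => //; rewrite ?expR_ge0 ?subr_ge0// gerBl.
move=> w s /andP[s0 sT].
have Ts : 0 <= T - s by rewrite subr_ge0.
(* Moving from [s] forward to [T - i] can only lose arrivals, which is the favourable direction for
   a deficit. *)
set i := Num.truncn (T - s).
have /andP[i1 i2] := truncn_itv Ts.
rewrite -/i in i1 i2; rewrite -natr1 in i2.
have iT : (i \in iota 0 (Num.truncn T).+1).
  by rewrite mem_iota /= add0n ltnS /i le_truncn// gerBl.
have s1 : s <= T - i%:R by lra.
have Ti : 0 <= T - i%:R by lra.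
have N1 : (N s w <= N (T - i%:R)%R w)%N by apply: (poisson_nondecreasing HN).
have N2 : (N (T - i%:R)%R w <= N T w)%N.
  by apply: (poisson_nondecreasing HN) => //; rewrite gerBl.
set D := (N T w - N (T - i%:R)%R w)%N.
have DE : D%:R = (N T w)%:R - (N (T - i%:R) w)%:R :> R by rewrite natrB.
apply: (@le_trans _ _ (b + (b * i%:R - D%:R))).
  have : b * (T - s) <= b * (i%:R + 1) by rewrite ler_pM2l// ltW.
  by rewrite DE; move: N1; rewrite -(ler_nat R); lra.
rewrite lerD2l; apply: le_trans (le_expR_div _ e0) _.
rewrite ler_pM2l ?invr_gt0// (bigD1_seq i) ?iota_uniq//= -/D.
have -> : expR (eta * b) ^+ i * z ^+ D = expR (eta * (b * i%:R - D%:R)).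
  by rewrite /z -!expRM_natl -expRD; congr expR; ring.
rewrite lerDl sumr_ge0// => j _.
by rewrite mulr_ge0// exprn_ge0// expR_ge0.
Qed.

(** A point of the grid of integer remaining times, clamped at 0. It lies strictly before [s] unless
    it is 0, so the arrivals after it include those at the instant [s] itself. *)
Definition previous_cell {R : realType} (T s : R) : R :=
  Num.max 0 (T - (Num.truncn (T - s)).+1%:R).

(** Mirror image of [poisson_deficit]: an upper bound on arrivals needs the window enlarged, so
    counting starts from the previous grid point. *)
Lemma poisson_excess (R : realType) (lam b : R) : 0 < lam -> lam < b ->
  exists C : R, forall (d : measure_display) (Omega : measurableType d)
    (P : probability Omega R) (N : R -> Omega -> nat),
    poisson_process P lam N -> forall T : R, 0 < T ->
    exists2 f, mean_le P f C & forall w (s : R), 0 <= s <= T ->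
      (N T w)%:R - (N (previous_cell T s) w)%:R - b * (T - s) <= f w.
Proof.
move=> l0 bl; have b0 : 0 < b by exact: lt_trans bl.
have bnl : b != lam by rewrite gt_eqF.
have [eta' se he] := cramer_exponent l0 b0 bnl.
(* Since [lam < b] the Cramer exponent is negative; from here on [eta] is its absolute value. *)
have [eta etaE] : exists eta, eta' = - eta by exists (- eta'); rewrite opprK.
rewrite {}etaE opprK {eta'} in he se.
have e0 : 0 < eta by move: se; rewrite mulNr -mulrN opprB pmulr_lgt0 ?subr_gt0.
set z := expR eta in he *.
have z1 : 0 <= z - 1 by rewrite subr_ge0 /z -expR0 ler_expR ltW.
set rho := expR (- eta * b + lam * (z - 1)).
have r1 : 0 <= rho < 1 by rewrite expR_ge0 expR_lt1.
have c0 : 0 <= eta^-1 by rewrite invr_ge0 ltW.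
exists (eta^-1 * (expR (lam * (z - 1)) * (1 - rho)^-1)) => d Omega P N HN T T0.
pose r (i : nat) : R := Num.max 0 (T - i.+1%:R).
exists (fun w => eta^-1 * \sum_(i <- iota 0 (Num.truncn T).+1)
   (expR (- eta * b) ^+ i * z ^+ (N T w - N (r i) w))).
  apply: mean_leZ => //.
  apply: (mean_le_weaken (ler_wpM2l (expR_ge0 _) (geometric_sum_le (Num.truncn T).+1 r1))).
  rewrite mulr_sumr; apply: mean_le_sum => i _.
  have r0 : 0 <= r i by rewrite le_max lexx.
  have rT : r i <= T by rewrite ge_max (ltW T0) gerBl ler0n.
  (* The window has length at most [i + 1]; the extra unit contributes the constant factor
     [expR (lam * (z - 1))]. *)
  have /mean_le_weaken : expR (- eta * b) ^+ i * expR (lam * (T - r i) * (z - 1))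
      <= expR (lam * (z - 1)) * rho ^+ i.
    rewrite -!expRM_natl -!expRD ler_expR.
    have -> : lam * (z - 1) + i%:R * (- eta * b + lam * (z - 1)) =
      i%:R * (- eta * b) + lam * (i%:R + 1) * (z - 1) by ring.
    rewrite lerD2l ler_wpM2r// ler_pM2l// natr1.
    by rewrite lerBlDr addrC -lerBlDr le_max lexx orbT.
  apply; apply: mean_leZ; first by rewrite exprn_ge0// expR_ge0.
  by apply: mean_le_poisson => //; rewrite expR_ge0.
move=> w s /andP[s0 sT].
have Ts : 0 <= T - s by rewrite subr_ge0.
rewrite /previous_cell; set i := Num.truncn (T - s); rewrite -/(r i).
have /andP[i1 i2] := truncn_itv Ts; rewrite -/i in i1 i2.
have iT : (i \in iota 0 (Num.truncn T).+1).
  by rewrite mem_iota /= add0n ltnS /i le_truncn// gerBl.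
have r0 : 0 <= r i by rewrite le_max lexx.
have rT : r i <= T by rewrite ge_max (ltW T0) gerBl ler0n.
have N1 : (N (r i) w <= N T w)%N by apply: (poisson_nondecreasing HN).
set D := (N T w - N (r i) w)%N.
have DE : D%:R = (N T w)%:R - (N (r i) w)%:R :> R by rewrite natrB.
apply: (@le_trans _ _ (D%:R - b * i%:R)).
  have : b * i%:R <= b * (T - s) by rewrite ler_pM2l.
  by rewrite DE; lra.
apply: le_trans (le_expR_div _ e0) _.
rewrite ler_pM2l ?invr_gt0// (bigD1_seq i) ?iota_uniq//= -/D.
have -> : expR (- eta * b) ^+ i * z ^+ D = expR (eta * (D%:R - b * i%:R)).
  by rewrite /z -!expRM_natl -expRD; congr expR; ring.
rewrite lerDl sumr_ge0// => j _.
by rewrite mulr_ge0// exprn_ge0// expR_ge0.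
Qed.

(** Only [k >= 2] needs an argument: then [k - 1 <= 2 ^ (k - 2) <= z ^ (k - 2)]. *)
Lemma natr_le_exp_cell (R : realType) (z k : nat) : (1 < z)%N ->
  k%:R <= 1 + (z%:R ^+ 2)^-1 * z%:R ^+ k :> R.
Proof.
move=> z1; have z0 : 0 < (z%:R : R) by rewrite ltr0n ltnW.
case: k => [|[|k]].
- by rewrite addr_ge0// mulr_ge0 ?invr_ge0 ?exprn_ge0// ltW.
- by rewrite lerDl mulr_ge0 ?invr_ge0 ?exprn_ge0// ltW.
rewrite -[k.+2]addn2 exprD mulrCA mulVf ?mulr1; last by rewrite expf_neq0// gt_eqF.
rewrite -natrX -[1]/(1%:R) -natrD ler_nat addn2 add1n ltnS.
apply: leq_trans (_ : 2 ^ k <= _)%N; first exact: ltn_expl.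
by case: k => // k; rewrite leq_exp2r.
Qed.

(* With m = z^2 cells, the bound D <= 1 + z^D / m makes the total mean of the
   second summands at most exp(1), so no almost-sure statement about
   simultaneous arrivals is needed. *)
Lemma poisson_cell_bound (R : realType) (lam : R) (d : measure_display)
    (Omega : measurableType d) (P : probability Omega R) (N : R -> Omega -> nat)
    (T : R) (z : nat) :
  poisson_process P lam N -> 0 < lam -> 0 < T -> (1 < z)%N -> lam * T <= z%:R ->
  exists2 f, mean_le P f (1 + expR 1) & forall w i (s : R), (i < z ^ 2)%N ->
    T * i%:R / z%:R ^+ 2 <= s -> s <= T * i.+1%:R / z%:R ^+ 2 ->
    (N s w)%:R - (N (T * i%:R / z%:R ^+ 2) w)%:R <= f w.
Proof.
move=> HN l0 T0 z1 lz; have z0 : 0 < (z%:R : R) by rewrite ltr0n ltnW.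
pose m : R := z%:R ^+ 2; have m0 : 0 < m by rewrite exprn_gt0.
pose t (i : nat) := T * i%:R / m.
have t0 i : 0 <= t i by rewrite divr_ge0 ?mulr_ge0// ltW.
have tS i : t i <= t i.+1.
  by rewrite ler_pM2r ?invr_gt0// ler_pM2l// ler_nat.
exists (fun w => 1 + m^-1 * \sum_(i <- iota 0 (z ^ 2)) z%:R ^+ (N (t i.+1) w - N (t i) w)).
  apply: mean_leD; first exact: mean_le_cst.
  have -> : expR 1 = m^-1 * \sum_(i <- iota 0 (z ^ 2)) expR 1 :> R.
    rewrite big_const_seq count_predT size_iota iter_addr_0.
    by rewrite -mulr_natl natrX mulrA mulVf ?mul1r// gt_eqF.
  apply: mean_leZ; first by rewrite invr_ge0 ltW.
  apply: mean_le_sum => i _.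
  apply: mean_le_weaken (mean_le_poisson HN l0 (ltW z0) (t0 i) (tS i)).
  rewrite ler_expR.
  (* The exponent is at most 1, because [lam * T <= z] and [z - 1 <= z] while [m = z ^ 2]. *)
  have -> : lam * (t i.+1 - t i) * (z%:R - 1) = (lam * T) * (z%:R - 1) / m.
    by rewrite /t -natr1; ring.
  rewrite ler_pdivrMr// mul1r /m expr2 ler_pM ?mulr_ge0 ?subr_ge0 ?ler1n//.
  - exact: ltW.
  - exact: ltW.
  - exact: ltnW.
  - by rewrite gerBl.
move=> w i s im si1 si2.
have s0 : 0 <= s by apply: le_trans si1; exact: t0.
have N1 : (N (t i) w <= N (t i.+1) w)%N by apply: (poisson_nondecreasing HN).
have N2 : (N s w <= N (t i.+1) w)%N by apply: (poisson_nondecreasing HN).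
set D := (N (t i.+1) w - N (t i) w)%N.
have DE : D%:R = (N (t i.+1) w)%:R - (N (t i) w)%:R :> R by rewrite natrB.
apply: (@le_trans _ _ D%:R); first by rewrite DE lerD2r ler_nat.
apply: le_trans (@natr_le_exp_cell _ _ D z1) _.
rewrite lerD2l ler_pM2l ?invr_gt0// (bigD1_seq i) ?iota_uniq ?mem_iota//= lerDl.
by apply: sumr_ge0 => j _; rewrite exprn_ge0// ltW.
Qed.

(** * Aggregation over classes *)

Definition total_arrivals {R : realType} (A : nat -> R -> nat) (m : nat) (s : R) : R :=
  \sum_(1 <= j < m.+1) (A j s)%:R.

Section Aggregation.
Context {R : realType}.
Variables (m : nat) (lambda : nat -> R).
Hypothesis lambda_gt0 : forall j, (1 <= j <= m)%N -> 0 < lambda j.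

(** [Q] abstracts the pathwise bound, so that deficit and excess share one argument. The constants
    are chosen before the probability space and [T], which keeps their sum uniform. *)
Lemma mean_le_total (Q : nat -> forall (d : measure_display) (Omega : measurableType d)
     (P : probability Omega R), (R -> Omega -> nat) -> R -> (Omega -> R) -> Prop) :
  (forall j, (1 <= j <= m)%N -> exists C : R,
    forall (d : measure_display) (Omega : measurableType d)
      (P : probability Omega R) (N : R -> Omega -> nat),
      poisson_process P (lambda j) N -> forall T : R, 0 < T ->
      exists2 f, mean_le P f C & Q j d Omega P N T f) ->
  exists C : R, forall (d : measure_display) (Omega : measurableType d)
    (P : probability Omega R) (A : nat -> R -> Omega -> nat),
    (forall j, (1 <= j <= m)%N -> poisson_process P (lambda j) (A j)) ->
    forall T : R, 0 < T ->
    exists f : nat -> Omega -> R,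
      mean_le P (fun w => \sum_(1 <= j < m.+1) f j w) C /\
      forall j, (1 <= j <= m)%N -> Q j d Omega P (A j) T (f j).
Proof.
move=> H.
have /choice[C HC] : forall j, exists C : R, (1 <= j <= m)%N ->
    forall (d : measure_display) (Omega : measurableType d)
      (P : probability Omega R) (N : R -> Omega -> nat),
      poisson_process P (lambda j) N -> forall T : R, 0 < T ->
      exists2 f, mean_le P f C & Q j d Omega P N T f.
  move=> j; case: (boolP (1 <= j <= m)%N) => [/H[C HC]|_]; first by exists C.
  by exists 0.
exists (\sum_(1 <= j < m.+1) C j) => d Omega P A HA T T0.
have /choice[f Hf] : forall j, exists f : Omega -> R, (1 <= j <= m)%N ->
    mean_le P f (C j) /\ Q j d Omega P (A j) T f.
  move=> j; case: (boolP (1 <= j <= m)%N) => jm; last by exists (fun=> 0).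
  by have [f f1 f2] := HC j jm _ _ P _ (HA j jm) T T0; exists f.
exists f; split; last by move=> j /Hf[].
apply: mean_le_sum => j; rewrite mem_index_iota ltnS => jm.
by have [] := Hf j jm.
Qed.

Hypothesis m_gt0 : (0 < m)%N.
Variable beta : R.
Hypothesis beta_gt0 : 0 < beta.
Let Lambda := \sum_(1 <= j < m.+1) lambda j.

Let Lambda_gt0 : 0 < Lambda.
Proof.
rewrite /Lambda big_nat_recl// ltr_wpDr ?lambda_gt0//.
rewrite big_nat_cond sumr_ge0// => j; rewrite andbT => /andP[j1 jm].
by rewrite ltW// lambda_gt0.
Qed.

(* the part of the drift [beta] allotted to class [j] *)
Let share j := lambda j * (beta / Lambda).

Let share_gt0 j : (1 <= j <= m)%N -> 0 < share j.
Proof. by move=> jm; rewrite mulr_gt0 ?lambda_gt0// divr_gt0. Qed.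

Let sum_share (x : R) : \sum_(1 <= j < m.+1) share j * x = beta * x.
Proof.
rewrite -mulr_suml -mulr_suml -/Lambda; congr (_ * _).
by rewrite mulrC divfK// gt_eqF.
Qed.

Lemma total_deficit : beta < Lambda ->
  exists C : R, forall (d : measure_display) (Omega : measurableType d)
    (P : probability Omega R) (A : nat -> R -> Omega -> nat),
    (forall j, (1 <= j <= m)%N -> poisson_process P (lambda j) (A j)) ->
    forall T : R, 0 < T ->
    exists2 f, mean_le P f C & forall w (s : R), 0 <= s <= T ->
      beta * (T - s) - (total_arrivals (fun j u => A j u w) m T
                        - total_arrivals (fun j u => A j u w) m s) <= f w.
Proof.
move=> bL.
pose Q j (d : measure_display) (Omega : measurableType d)
     (P : probability Omega R) (N : R -> Omega -> nat) T (f : Omega -> R) :=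
  forall w (s : R), 0 <= s <= T -> share j * (T - s) - ((N T w)%:R - (N s w)%:R) <= f w.
have [|C HC] := @mean_le_total Q.
  move=> j jm; apply: poisson_deficit; first exact: share_gt0.
  (* A proportional split puts each share on the same side of its rate as [beta] is of [Lambda]. *)
  by rewrite /share gtr_pMr ?lambda_gt0// ltr_pdivrMr// mul1r.
exists C => d Omega P A HA T T0; have [f [fC Hf]] := HC _ _ P A HA T T0.
exists (fun w => \sum_(1 <= j < m.+1) f j w) => // w s sT.
rewrite /total_arrivals -sum_share -!sumrB ler_sum_nat// => j; rewrite ltnS => jm.
exact: Hf.
Qed.

Lemma total_excess : Lambda < beta ->
  exists C : R, forall (d : measure_display) (Omega : measurableType d)
    (P : probability Omega R) (A : nat -> R -> Omega -> nat),
    (forall j, (1 <= j <= m)%N -> poisson_process P (lambda j) (A j)) ->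
    forall T : R, 0 < T ->
    exists2 f, mean_le P f C & forall w (s : R), 0 <= s <= T ->
      total_arrivals (fun j u => A j u w) m T
      - total_arrivals (fun j u => A j u w) m (previous_cell T s)
      - beta * (T - s) <= f w.
Proof.
move=> bL.
pose Q j (d : measure_display) (Omega : measurableType d)
     (P : probability Omega R) (N : R -> Omega -> nat) T (f : Omega -> R) :=
  forall w (s : R), 0 <= s <= T ->
    (N T w)%:R - (N (previous_cell T s) w)%:R - share j * (T - s) <= f w.
have [|C HC] := @mean_le_total Q.
  move=> j jm; apply: poisson_excess; first exact: lambda_gt0.
  by rewrite /share ltr_pMr ?lambda_gt0// ltr_pdivlMr// mul1r.
exists C => d Omega P A HA T T0; have [f [fC Hf]] := HC _ _ P A HA T T0.
exists (fun w => \sum_(1 <= j < m.+1) f j w) => // w s sT.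
rewrite /total_arrivals -sum_share -!sumrB ler_sum_nat// => j; rewrite ltnS => jm.
exact: Hf.
Qed.

(** Bounds the arrivals at a single instant, simultaneous ones included, by those since an earlier
    point [r] of a fine grid. All classes use the same grid, so one [r] serves them all. *)
Lemma total_jump : exists C : R,
  forall (d : measure_display) (Omega : measurableType d)
    (P : probability Omega R) (A : nat -> R -> Omega -> nat),
    (forall j, (1 <= j <= m)%N -> poisson_process P (lambda j) (A j)) ->
    forall T : R, 0 < T ->
    exists2 f, mean_le P f C & forall w (s : R), 0 < s <= T ->
      exists2 r, 0 <= r < s &
        total_arrivals (fun j u => A j u w) m s
        - total_arrivals (fun j u => A j u w) m r <= f w.
Proof.
exists (\sum_(1 <= j < m.+1) (1 + expR 1)) => d Omega P A HA T T0.
(* Large enough that [z >= 2] and that [z] exceeds [Lambda * T], hence every [lambda j * T]. *)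
pose z := (Num.truncn (Lambda * T)).+2.
have z0 : 0 < (z%:R : R) ^+ 2 by rewrite exprn_gt0.
have lz j : (1 <= j <= m)%N -> lambda j * T <= z%:R.
  move=> jm; apply: (@le_trans _ _ (Lambda * T)).
    rewrite ler_pM2r// /Lambda (bigD1_seq j) ?iota_uniq ?mem_index_iota//=.
    rewrite lerDl big_seq_cond sumr_ge0// => i; rewrite mem_index_iota ltnS => /andP[im _].
    by rewrite ltW// lambda_gt0.
  have /andP[_ /ltW h] := truncn_itv (ltW (mulr_gt0 Lambda_gt0 T0)).
  by apply: le_trans h _; rewrite ler_nat.
have /choice[f Hf] : forall j, exists f : Omega -> R, (1 <= j <= m)%N ->
    mean_le P f (1 + expR 1) /\ forall w i (s : R), (i < z ^ 2)%N ->
    T * i%:R / z%:R ^+ 2 <= s -> s <= T * i.+1%:R / z%:R ^+ 2 ->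
    (A j s w)%:R - (A j (T * i%:R / z%:R ^+ 2) w)%:R <= f w.
  move=> j; case: (boolP (1 <= j <= m)%N) => jm; last by exists (fun=> 0).
  have [//|f f1 f2] := poisson_cell_bound (HA j jm) (lambda_gt0 jm) T0 _ (lz j jm).
  by exists f.
exists (fun w => \sum_(1 <= j < m.+1) f j w).
  apply: mean_le_sum => j; rewrite mem_index_iota ltnS => jm.
  by have [] := Hf j jm.
move=> w s /andP[s0 sT].
(* Take the least index whose right endpoint reaches [s]; minimality puts the left endpoint strictly
   before [s]. *)
have [i [im i1 i2]] : exists i, [/\ (i < z ^ 2)%N, T * i%:R / z%:R ^+ 2 < s &
    s <= T * i.+1%:R / z%:R ^+ 2].
  have ex : exists i, s <= T * i.+1%:R / z%:R ^+ 2.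
    exists (z ^ 2).-1; rewrite prednK ?expn_gt0// natrX mulfK//.
    by rewrite gt_eqF.
  case: (ex_minnP ex) => i i1 imin; exists i; split => //.
    rewrite -[ltnRHS]prednK ?expn_gt0// ltnS; apply: imin.
    by rewrite prednK ?expn_gt0// natrX mulfK// gt_eqF.
  case: i i1 imin => [|i] i1 imin; first by rewrite mulr0 mul0r.
  by rewrite ltNge; apply/negP => /imin; rewrite ltnn.
exists (T * i%:R / z%:R ^+ 2).
  rewrite i1 andbT divr_ge0 ?mulr_ge0 ?exprn_ge0//; exact: ltW.
rewrite /total_arrivals -sumrB ler_sum_nat// => j; rewrite ltnS => jm.
by have [_ h] := Hf j jm; apply: h => //; exact: ltW.
Qed.

End Aggregation.

(** Adding the finitely many nonnegative dominating variables gives a single [f], so the pathwise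
    argument depends on the randomness only through one number [f w]. *)
Lemma uniform_path_bounds (R : realType) (K : nat) (lambda beta : nat -> R)
  (hlambda : forall j : nat, (1 <= j <= K)%N -> 0 < lambda j)
  (hbeta : forall j : nat, (1 <= j <= K.-1)%N ->
     \sum_(1 <= i < j.+1) lambda i < beta j
     /\ beta j < \sum_(1 <= i < j.+2) lambda i) : (1 < K)%N ->
  exists C : R, forall (d : measure_display) (Omega : measurableType d)
    (P : probability Omega R) (A : nat -> R -> Omega -> nat),
    (forall j, (1 <= j <= K)%N -> poisson_process P (lambda j) (A j)) ->
    forall T : R, 0 < T ->
    exists2 f, mean_le P f C & forall w,
      let N := total_arrivals (fun j u => A j u w) in
      [/\ forall k (s : R), (1 <= k <= K.-1)%N -> 0 <= s <= T ->
            beta k * (T - s) - (N k.+1 T - N k.+1 s) <= f w,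
          forall k (s : R), (1 <= k <= K.-1)%N -> 0 <= s <= T ->
            N k T - N k (previous_cell T s) - beta k * (T - s) <= f w &
          forall s : R, 0 < s <= T ->
            exists2 r, 0 <= r < s & N K s - N K r <= f w].
Proof.
move=> K1.
have lam m j : (m <= K)%N -> (1 <= j <= m)%N -> 0 < lambda j.
  by move=> mK /andP[j1 jm]; apply: hlambda; rewrite j1 (leq_trans jm).
have K0 : (0 < K)%N by apply: ltnW.
have Lam k : (1 <= k <= K.-1)%N -> 0 < beta k.
  move=> /[dup] /andP[k1 kK] /hbeta[h _]; apply: le_lt_trans h.
  rewrite big_nat_cond sumr_ge0// => j; rewrite andbT ltnS => /andP[j1 jm].
  rewrite ltW// hlambda// j1/= (leq_trans jm)// (leq_trans kK)//.
  exact: leq_pred.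
have /choice[CU HU] : forall k, exists C, (1 <= k <= K.-1)%N ->
  forall (d : measure_display) (Omega : measurableType d)
    (P : probability Omega R) (A : nat -> R -> Omega -> nat),
    (forall j, (1 <= j <= k.+1)%N -> poisson_process P (lambda j) (A j)) ->
    forall T : R, 0 < T ->
    exists2 f, mean_le P f C & forall w (s : R), 0 <= s <= T ->
      beta k * (T - s) - (total_arrivals (fun j u => A j u w) k.+1 T
                        - total_arrivals (fun j u => A j u w) k.+1 s) <= f w.
  move=> k; case: (boolP (1 <= k <= K.-1)%N) => kK; last by exists 0.
  have [|C HC] := @total_deficit R k.+1 lambda _ isT (beta k) (Lam k kK) (hbeta k kK).2.
    by move=> j; apply: lam; move: kK => /andP[_]; case: (K) K0.
  by exists C.
have /choice[CL HL] : forall k, exists C, (1 <= k <= K.-1)%N ->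
  forall (d : measure_display) (Omega : measurableType d)
    (P : probability Omega R) (A : nat -> R -> Omega -> nat),
    (forall j, (1 <= j <= k)%N -> poisson_process P (lambda j) (A j)) ->
    forall T : R, 0 < T ->
    exists2 f, mean_le P f C & forall w (s : R), 0 <= s <= T ->
      total_arrivals (fun j u => A j u w) k T
      - total_arrivals (fun j u => A j u w) k (previous_cell T s)
      - beta k * (T - s) <= f w.
  move=> k; case: (boolP (1 <= k <= K.-1)%N) => kK; last by exists 0.
  have [k1 kK'] := andP kK.
  have [|C HC] := @total_excess R k lambda _ k1 (beta k) (hbeta k kK).1.
    by move=> j; apply: lam; rewrite (leq_trans kK') ?leq_pred.
  by exists C.
have [CO HO] := total_jump hlambda K0.
exists (\sum_(1 <= k < K) (CU k + CL k) + CO) => d Omega P A HA T T0.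
have /choice[fU HfU] : forall k, exists f, (1 <= k <= K.-1)%N ->
  mean_le P f (CU k) /\ forall w (s : R), 0 <= s <= T ->
      beta k * (T - s) - (total_arrivals (fun j u => A j u w) k.+1 T
                        - total_arrivals (fun j u => A j u w) k.+1 s) <= f w.
  move=> k; case: (boolP (1 <= k <= K.-1)%N) => kK; last by exists (fun=> 0).
  have [|f f1 f2] := HU k kK _ _ P A _ T T0; last by exists f.
  move=> j /andP[j1 jk]; apply: HA; rewrite j1 (leq_trans jk)//.
  by move: kK => /andP[_]; case: (K) K0.
have /choice[fL HfL] : forall k, exists f, (1 <= k <= K.-1)%N ->
  mean_le P f (CL k) /\ forall w (s : R), 0 <= s <= T ->
      total_arrivals (fun j u => A j u w) k T
      - total_arrivals (fun j u => A j u w) k (previous_cell T s)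
      - beta k * (T - s) <= f w.
  move=> k; case: (boolP (1 <= k <= K.-1)%N) => kK; last by exists (fun=> 0).
  have [|f f1 f2] := HL k kK _ _ P A _ T T0; last by exists f.
  move=> j /andP[j1 jk]; apply: HA; rewrite j1 (leq_trans jk)//.
  by move: kK => /andP[_ kK]; rewrite (leq_trans kK) ?leq_pred.
have [fO fOC HfO] := HO _ _ P A HA T T0.
have mU k : (1 <= k < K)%N -> mean_le P (fun w => fU k w + fL k w) (CU k + CL k).
  move=> /andP[k1 kK]; have kK' : (1 <= k <= K.-1)%N by rewrite k1 -ltnS prednK.
  by apply: mean_leD; [have [] := HfU k kK'|have [] := HfL k kK'].
have fO0 w : 0 <= fO w by have [_ ? _] := fOC.
have pos k w : (1 <= k <= K.-1)%N -> 0 <= fU k w /\ 0 <= fL k w.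
  by move=> kK; have [[_ h _] _] := HfU k kK; have [[_ g _] _] := HfL k kK.
exists (fun w => \sum_(1 <= k < K) (fU k w + fL k w) + fO w).
  apply: mean_leD => //; apply: mean_le_sum => k; rewrite mem_index_iota; exact: mU.
have le_sum k w : (1 <= k <= K.-1)%N ->
    fU k w + fL k w <= \sum_(1 <= k < K) (fU k w + fL k w) + fO w.
  move=> /andP[k1 kK].
  rewrite (bigD1_seq k) ?iota_uniq ?mem_index_iota//=; last first.
    by rewrite k1/= -(prednK K0) ltnS.
  rewrite -addrA lerDl addr_ge0//.
  rewrite big_seq_cond sumr_ge0// => i; rewrite mem_index_iota => /andP[/mU[_ h _] _].
  exact: h.
move=> w N; split.
- move=> k s kK sT; have [_ /(_ w s sT) h] := HfU k kK.
  apply: le_trans h _; apply: le_trans (le_sum k w kK).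
  by rewrite lerDl (pos k w kK).2.
- move=> k s kK sT; have [_ /(_ w s sT) h] := HfL k kK.
  apply: le_trans h _; apply: le_trans (le_sum k w kK).
  by rewrite lerDr (pos k w kK).1.
- move=> s sT; have [r r0 h] := HfO w s sT; exists r => //.
  apply: le_trans h _; rewrite lerDr big_nat_cond sumr_ge0// => i.
  by rewrite andbT => /mU[_ h _].
Qed.

(** * Threshold policies on a list of customers *)

Section Policies.
Context {R : realType}.
Variable p : nat -> R.
Implicit Types (acc : R -> nat -> int -> bool) (l : seq (R * nat)) (x : int).

Fixpoint policy_revenue acc l x : R :=
  if l is (s, j) :: l' then
    if acc s j x then (if 0 < x then p j else 0) + policy_revenue acc l' (x - 1)
    else policy_revenue acc l' x
  else 0.

Fixpoint final_inventory acc l x : int :=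
  if l is (s, j) :: l' then
    final_inventory acc l' (if acc s j x then x - 1 else x)
  else x.

Definition class_count (m : nat) l : nat := count (fun c => (c.2 <= m)%N) l.

Lemma final_inventory_cat acc l1 l2 x :
  final_inventory acc (l1 ++ l2) x = final_inventory acc l2 (final_inventory acc l1 x).
Proof. by elim: l1 x => [|[s j] l1 IH] x //=. Qed.

Lemma final_inventory_nested acc (k : nat) l x :
  (forall c y, c \in l -> acc c.1 c.2 y = (c.2 <= k)%N) ->
  (final_inventory acc l x)%:~R = x%:~R - (class_count k l)%:R :> R.
Proof.
elim: l x => [|[s j] l IH] x h /=; first by rewrite subr0.
rewrite IH => [|c y cl]; last by apply: h; rewrite inE cl orbT.
rewrite (h (s, j) x (mem_head _ _)) /class_count /=.
by case: ifP => _; rewrite ?natrD ?intrB//=; ring.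
Qed.

Section Threshold.
Variables (k : nat) (b T : R) (acc : R -> nat -> int -> bool).

Let threshold l := forall c y, c \in l ->
  acc c.1 c.2 y = (c.2 <= k)%N || ((c.2 == k.+1) && (b * (T - c.1) <= y%:~R)).

(** Induction with the invariant that [x] minus the class [<= k+1] customers still to come is at
    most [U]. Acceptances and classes above [k+1] leave it unchanged. A rejected class-[k+1]
    customer finds [x] below the line, where the hypothesis at that customer restores the
    invariant. *)
Lemma final_inventory_le l x (U : R) : threshold l ->
  (forall l0 c l', l = l0 ++ c :: l' ->
     b * (T - c.1) - (class_count k.+1 l')%:R <= U) ->
  x%:~R - (class_count k.+1 l)%:R <= U -> (final_inventory acc l x)%:~R <= U.
Proof.
elim: l x => [|[s j] l IH] x h hU /=; first by rewrite subr0.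
move=> xU; apply: IH.
- by move=> c y cl; apply: h; rewrite inE cl orbT.
- by move=> l0 c l' ll; apply: (hU ((s, j) :: l0)); rewrite ll.
have := hU [::] (s, j) l erefl; rewrite /= => sU.
move: xU; rewrite (h (s, j) x (mem_head _ _)) /class_count /= -/(class_count _ _).
rewrite natrD.
case: (leqP j k) => jk /=; first by rewrite (leqW jk) intrB /=; lra.
case: (eqVneq j k.+1) => [->|jk'] /=.
  rewrite leqnn /=; case: (leP (b * (T - s)) _) => bs; first by rewrite intrB /=; lra.
  by move=> _; move: sU; rewrite /class_count; lra.
have -> : (j <= k.+1)%N = false 
  by apply: negbTE; rewrite -ltnNge ltn_neqAle eq_sym jk' jk.
by rewrite /=; lra.
Qed.

(** Dual invariant: the class [<= k] customers still to come minus [x] is at most [L]. Only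
    accepting class [k+1] can break it; then [x] was at or above the line, and the unit just used
    accounts for the [+ 1]. *)
Lemma final_inventory_ge l x (L : R) : threshold l ->
  (forall l0 c l', l = l0 ++ c :: l' ->
     (class_count k l')%:R - b * (T - c.1) + 1 <= L) ->
  (class_count k l)%:R - x%:~R <= L -> - L <= (final_inventory acc l x)%:~R.
Proof.
elim: l x => [|[s j] l IH] x h hL /=; first by rewrite /class_count /= => ?; lra.
move=> xL; apply: IH.
- by move=> c y cl; apply: h; rewrite inE cl orbT.
- by move=> l0 c l' ll; apply: (hL ((s, j) :: l0)); rewrite ll.
have := hL [::] (s, j) l erefl; rewrite /= => sL.
move: xL; rewrite (h (s, j) x (mem_head _ _)) /class_count /= -/(class_count _ _).
rewrite natrD.
case: (leqP j k) => jk /=; first by rewrite intrB /=; lra.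
case: (j == k.+1) => /=; last by lra.
case: (leP (b * (T - s)) _) => bs; last by lra.
by rewrite intrB /=; move: sL; rewrite /class_count; lra.
Qed.

End Threshold.

(* The price [q] separates accepted from rejected classes, so every customer
   contributes at least [max (p_j - q) 0 + q * (accepted)] to the virtual revenue;
   the acceptances made at inventory [<= 0] are the ones lost. *)
Lemma policy_revenue_ge acc l x (q p1 : R) : 0 <= q ->
  (forall c y, c \in l -> acc c.1 c.2 y -> q <= p c.2) ->
  (forall c y, c \in l -> ~~ acc c.1 c.2 y -> p c.2 <= q) ->
  (forall c, c \in l -> p c.2 <= p1) ->
  \sum_(c <- l) Num.max (p c.2 - q) 0 + q * (x%:~R - (final_inventory acc l x)%:~R)
    + p1 * Num.max 0 (- x%:~R)
  <= policy_revenue acc l x + p1 * Num.max 0 (- (final_inventory acc l x)%:~R).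
Proof.
move=> q0; elim: l x => [|[s j] l IH] x ha hr hp /=.
  by rewrite big_nil; lra.
have {}IH y : \sum_(c <- l) Num.max (p c.2 - q) 0 +
    q * (y%:~R - (final_inventory acc l y)%:~R) + p1 * Num.max 0 (- y%:~R)
  <= policy_revenue acc l y + p1 * Num.max 0 (- (final_inventory acc l y)%:~R).
  apply: IH => [c z cl|c z cl|c cl]; [apply: ha|apply: hr|apply: hp]; by rewrite inE cl orbT.
have {}ha := ha (s, j) x (mem_head _ _).
have {}hr := hr (s, j) x (mem_head _ _).
have {}hp := hp (s, j) (mem_head _ _).
rewrite /= in ha hr hp; rewrite big_cons /=.
case: (boolP (acc s j x)) => [aj|rj].
  have qp := ha aj; have := IH (x - 1).
  rewrite (max_l (y := 0)) ?subr_ge0// intrB /=.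
  case: (ltP 0 x) => x0.
    have x1 : 1 <= (x%:~R : R) by rewrite -[1]/(1%:~R) ler_int.
    have -> : Num.max 0 (- x%:~R) = 0 :> R by rewrite max_l//; lra.
    have -> : Num.max 0 (- (x%:~R - 1)) = 0 :> R by rewrite max_l//; lra.
    lra.
  have x1 : (x%:~R : R) <= 0 by rewrite -[0]/(0%:~R) ler_int.
  have -> : Num.max 0 (- x%:~R) = - x%:~R :> R by rewrite max_r//; lra.
  have -> : Num.max 0 (- (x%:~R - 1)) = 1 - x%:~R :> R by rewrite max_r; lra.
  lra.
have pq := hr rj; have := IH x.
by rewrite (max_r (x := p j - q)) ?subr_le0//; lra.
Qed.

End Policies.

(** * Arrival times and counts on one realization *)

(** What the deterministic argument uses of one trajectory. For integer values, right continuity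
    means being constant on a short interval to the right. *)
Record counting_path {R : realType} (a : R -> nat) : Prop := CountingPath {
  counting_start : a 0 = 0%N ;
  counting_mono : forall s t, 0 <= s -> s <= t -> (a s <= a t)%N ;
  counting_right_constant : forall s, 0 <= s ->
    exists2 e, 0 < e & forall u, s <= u -> u < s + e -> a u = a s }.

Lemma poisson_counting_path (d : measure_display) (Omega : measurableType d)
    (R : realType) (P : probability Omega R) (rate : R) (N : R -> Omega -> nat) w :
  poisson_process P rate N -> counting_path (N ^~ w).
Proof.
move=> HN; split.
- exact: (poisson_start HN).
- by move=> s t s0 st; apply: (poisson_nondecreasing HN).
(* Singletons are neighbourhoods in the discrete topology of [nat]. *)
move=> s s0; have : nbhs (N s w) [set N s w] by rewrite nbhs_principalE.
move=> /(poisson_right_continuous HN (w := w) s0) /= [e /= e0 he].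
exists e => // u su us.
move: su; rewrite le_eqVlt => /predU1P[<-//|su].
have /= := he u; apply => //.
by rewrite /= ltr0_norm; lra.
Qed.

Lemma previous_cell_ge0 (R : realType) (T s : R) : 0 <= previous_cell T s.
Proof. by rewrite le_max lexx. Qed.

Lemma previous_cell_lt (R : realType) (T s : R) : 0 <= s <= T ->
  previous_cell T s < s \/ previous_cell T s = 0.
Proof.
move=> /andP[s0 sT]; rewrite /previous_cell; set i := Num.truncn _.
have Ts : 0 <= T - s by lra.
have /andP[_ h] := truncn_itv Ts; rewrite -/i in h.
by case: (leP (T - i.+1%:R) 0) => Ti; [right|left; lra].
Qed.

Lemma previous_cell_le (R : realType) (T s : R) : 0 <= s <= T -> previous_cell T s <= s.
Proof. by move=> /[dup] /andP[s0 _] /previous_cell_lt[/ltW|->]. Qed.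

Lemma count_leq_iota (a N : nat) : (a <= N)%N -> count (leq^~ a) (iota 1 N) = a.
Proof.
move=> aN; rewrite -(subnKC aN) iotaD count_cat.
have : all (leq^~ a) (iota 1 a).
  by apply/allP => i; rewrite mem_iota add1n ltnS => /andP[].
rewrite all_count => /eqP ->.
rewrite size_iota (_ : count _ _ = 0)%N ?addn0//; apply/eqP; rewrite -leqn0 leqNgt -has_count.
by apply/hasPn => i; rewrite mem_iota add1n -ltnNge => /andP[].
Qed.

Section ArrivalTimes.
Context {R : realType}.
Variables (K : nat) (T : R) (A : nat -> R -> nat).
Hypothesis T_ge0 : 0 <= T.
Hypothesis counting_A : forall j, (1 <= j <= K)%N -> counting_path (A j).

(** The infimum is attained: elements of the set lie arbitrarily close to it on the right, where the
    count already equals its value at the infimum. *)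
Lemma arrival_time_le (j i : nat) (s : R) : (1 <= j <= K)%N -> (i <= A j T)%N ->
  0 <= s -> (arrival_time A j i <= s) = (i <= A j s)%N.
Proof.
move=> /counting_A[_ mono rc] iT s0; rewrite /arrival_time.
set E := [set s : R | _].
have ET : E T by [].
have lbE : lbound E 0 by move=> u [].
have infE : has_inf E by split; [exists T|exists 0].
have i0 : 0 <= inf E by apply: lb_le_inf => //; exists T.
apply/idP/idP => [ls|is']; last by apply: ge_inf; [exists 0|].
have [e e0 he] := rc _ i0.
have [u [u0 iu] ue] := inf_adherent e0 infE.
have lu : inf E <= u by apply: ge_inf; [exists 0|].
by apply: leq_trans (mono _ _ i0 ls); rewrite -(he u lu ue).
Qed.

Notation customers := (customers K T A).
Notation total := (total_arrivals A).

Lemma customers_mem c : c \in customers -> [/\ (1 <= c.2 <= K)%N, 0 < c.1 & c.1 <= T].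
Proof.
rewrite mem_sort => /allpairsPdep[j [i [jK iA ->]]] /=.
move: jK iA; rewrite !mem_iota !add1n !ltnS => jK /andP[i1 iA]; split => //.
- rewrite ltNge arrival_time_le//.
  by rewrite (counting_start (counting_A jK)) -ltnNge.
- by rewrite arrival_time_le.
Qed.

Lemma customers_sorted : sorted (fun a b : R * nat => a.1 <= b.1) customers.
Proof. by apply: sort_sorted => a b; exact: le_total. Qed.

(** Passes from counting processes to the customer list: the class-[j] arrivals up to [s] are the
    indices [i <= A j s] among 1, ..., [A j T]. *)
Lemma total_arrivalsE (m : nat) (s : R) : (m <= K)%N -> 0 <= s <= T ->
  total m s = (count (fun c => (c.2 <= m)%N && (c.1 <= s)) customers)%:R.
Proof.
move=> mK /andP[s0 sT].
rewrite /total_arrivals -natr_sum /Defs.customers count_sort; congr (_%:R).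
rewrite -sum1_count [RHS]big_mkcond big_allpairs_dep /=.
rewrite (big_nat_widen _ _ K.+1)//= -/(index_iota 1 K.+1) /index_iota subSS subn0.
rewrite big_mkcond /=; apply: eq_big_seq => j; rewrite mem_iota add1n ltnS => jK.
rewrite ltnS; case: (leqP j m) => jm /=; last by rewrite big1.
under eq_big_seq => i.
  rewrite mem_iota add1n ltnS => /andP[_ iA]; rewrite (arrival_time_le jK iA s0); over.
rewrite -big_mkcond sum1_count count_leq_iota//.
by have [_ mono _] := counting_A jK; apply: mono.
Qed.

Definition count_after (m : nat) (s : R) (l : seq (R * nat)) : nat :=
  count (fun c => (c.2 <= m)%N && (s < c.1)) l.

Lemma total_arrivals_after (m : nat) (s : R) : (m <= K)%N -> 0 <= s <= T ->
  total m T - total m s = (count_after m s customers)%:R.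
Proof.
move=> mK sT; rewrite !total_arrivalsE ?T_ge0 ?lexx//; apply/eqP.
rewrite subr_eq -natrD eqr_nat /count_after; apply/eqP.
rewrite -count_predUI [X in (_ + X)%N](_ : _ = 0%N) ?addn0; last first.
  by apply/eqP; rewrite -leqn0 leqNgt -has_count; apply/hasPn => c _ /=; case: ltP; rewrite ?andbF.
apply: eq_in_count => c /customers_mem[_ _ cT] /=.
by rewrite cT andbT -andb_orr orbC; case: leP; rewrite ?andbT ?andbT.
Qed.

Lemma total_arrivals_mono (m m' : nat) (r s : R) : (m <= m')%N -> (m' <= K)%N ->
  0 <= r -> r <= s -> s <= T -> total m s - total m r <= total m' s - total m' r.
Proof.
move=> mm' mK r0 rs sT.
rewrite /total_arrivals -!sumrB [leRHS](@big_cat_nat _ _ _ m.+1)//=.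
rewrite lerDl big_nat_cond sumr_ge0// => j; rewrite andbT ltnS => /andP[j1 jm].
have jK : (1 <= j <= K)%N by rewrite (leq_trans _ j1)//= (leq_trans jm).
have [_ mono _] := counting_A jK; by rewrite subr_ge0 ler_nat mono.
Qed.

Lemma total_arrivals_le (m : nat) (r s : R) : (m <= K)%N ->
  0 <= r -> r <= s -> s <= T -> total m r <= total m s.
Proof.
move=> mK r0 rs sT; have := total_arrivals_mono (leq0n m) mK r0 rs sT.
have t0 u : total 0 u = 0 by rewrite /total_arrivals big_geq.
by rewrite !t0 subr0 subr_ge0.
Qed.

Lemma total_arrivals0 (m : nat) : (m <= K)%N -> total m 0 = 0.
Proof.
move=> mK; rewrite /total_arrivals big_nat_cond big1// => j; rewrite andbT ltnS => /andP[j1 jm].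
by rewrite counting_start//; apply: counting_A; rewrite j1 (leq_trans jm).
Qed.

Lemma total_arrivals_right_constant (m : nat) (s : R) : (m <= K)%N -> 0 <= s ->
  exists2 e, 0 < e & forall u, s <= u -> u < s + e -> total m u = total m s.
Proof.
move=> + s0; elim: m => [|m IH] mK.
  by exists 1 => // u _ _; rewrite /total_arrivals !big_geq.
have [e e0 he] := IH (ltnW mK).
have [_ _ /(_ s s0)[e' e'0 he']] := counting_A (j := m.+1) mK.
exists (Num.min e e'); first by rewrite lt_min e0.
move=> u su us; rewrite /total_arrivals !(big_nat_recr m.+1)//=.
rewrite -/(total_arrivals A m u) -/(total_arrivals A m s).
rewrite he ?he'//; apply: lt_le_trans us _; rewrite lerD2l ge_min lexx ?orbT//.
Qed.

End ArrivalTimes.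

(** * Pathwise regret of the LT policy *)

Section PathwiseRegret.
Context {R : realType}.
Variables (K : nat) (p beta : nat -> R) (n : nat) (T : R) (A : nat -> R -> nat).
Hypothesis K_gt2 : (2 < K)%N.
Hypothesis p_decr : forall i j : nat, (1 <= i)%N -> (i < j)%N -> (j <= K)%N -> p j < p i.
Hypothesis p_gt0 : 0 < p K.
Hypothesis T_gt0 : 0 < T.
Hypothesis counting_A : forall j, (1 <= j <= K)%N -> counting_path (A j).

Let T_ge0 : 0 <= T := ltW T_gt0.
Notation customers := (customers K T A).
Notation total := (total_arrivals A).
Let rule (s : R) (j : nat) (x : int) := LT_accepts K beta n T A (T - s) j x.
Let final : R := (final_inventory rule customers n%:Z)%:~R.

Lemma price_le i j : (1 <= i)%N -> (i <= j)%N -> (j <= K)%N -> p j <= p i.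
Proof.
move=> i1; rewrite leq_eqVlt => /predU1P[->//|ij] jK.
by rewrite ltW// p_decr.
Qed.

Lemma price_ge0 j : (1 <= j <= K)%N -> 0 <= p j.
Proof. by move=> /andP[j1 jK]; apply: le_trans (ltW p_gt0) (price_le _ _ _). Qed.

Lemma LT_revenueE : LT_revenue K p beta n T A = policy_revenue p rule customers n%:Z.
Proof.
rewrite /LT_revenue; elim: customers n%:Z => [|[s j] l IH] x //=.
by rewrite !IH.
Qed.

(** Weak duality with [q] as the price of a unit: a chosen customer brings at most [q] plus the
    positive part of [p - q], and at most [n] are chosen. *)
Lemma hindsight_revenue_le (q : R) : 0 <= q ->
  hindsight_revenue K p n T A <= q * n%:R + \sum_(c <- customers) Num.max (p c.2 - q) 0.
Proof.
move=> q0; rewrite /hindsight_revenue.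
set W := \sum_(c <- _) _.
have -> : W = \sum_(i < size customers)
    Num.max (p (nth 0%N [seq a.2 | a <- customers] i) - q) 0.
  rewrite /W (big_nth (0, 0%N)) big_mkord; apply: eq_bigr => i _.
  by rewrite (nth_map (0, 0%N)).
pose pi (i : 'I_(size customers)) := p (nth 0%N [seq a.2 | a <- customers] i).
apply/bigmax_leP; split.
  by rewrite addr_ge0 ?mulr_ge0// sumr_ge0// => i _; rewrite le_max lexx orbT.
move=> S Sn.
apply: (@le_trans _ _ (\sum_(i in S) (q + Num.max (pi i - q) 0))).
  by apply: ler_sum => i _; rewrite -lerBlDl le_max lexx.
rewrite big_split/= sumr_const -[q *+ _]mulr_natr lerD//.
  by rewrite ler_wpM2l// ler_nat.
rewrite big_mkcond/=; apply: ler_sum => i _; case: ifP => // _.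
by rewrite le_max lexx orbT.
Qed.

(** The sum of positive parts occurs in both the hindsight and the policy bound and cancels. What
    remains is the value of leftover units at price [q] and the loss on oversold units. *)
Lemma regret_le (q : R) : 0 <= q ->
  (forall c y, c \in customers -> rule c.1 c.2 y -> q <= p c.2) ->
  (forall c y, c \in customers -> ~~ rule c.1 c.2 y -> p c.2 <= q) ->
  hindsight_revenue K p n T A - LT_revenue K p beta n T A
    <= q * final + p 1%N * Num.max 0 (- final).
Proof.
move=> q0 ha hr; rewrite LT_revenueE.
have := @policy_revenue_ge R p rule customers n%:Z q (p 1%N) q0 ha hr.
have h c : c \in customers -> p c.2 <= p 1%N.
  by move=> /(customers_mem T_ge0 counting_A)[/andP[c1 cK] _ _]; apply: price_le.
move=> /(_ h); rewrite -/final (max_l (y := - _%:~R)) ?oppr_le0 ?ler0z//.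
have := hindsight_revenue_le q0.
rewrite -pmulrn; lra.
Qed.

(** In a sorted list every arrival strictly later than [c] stands behind it; ties can only enlarge
    [l']. *)
Lemma customers_suffix_le m l0 c l' : (m <= K)%N -> customers = l0 ++ c :: l' ->
  total m T - total m c.1 <= (class_count m l')%:R.
Proof.
move=> mK E.
have [_ c0 cT] : [/\ (1 <= c.2 <= K)%N, 0 < c.1 & c.1 <= T].
  by apply: (customers_mem T_ge0 counting_A); rewrite E mem_cat mem_head orbT.
rewrite (total_arrivals_after T_ge0 counting_A) ?(ltW c0)// ler_nat E /count_after.
have trR : transitive (fun a b : R * nat => a.1 <= b.1).
  by move=> a b d; exact: le_trans.
have := customers_sorted K T A; rewrite E sorted_pairwise// pairwise_cat => /and3P[/allrelP h _ _].
rewrite count_cat /= ltxx andbF add0n (_ : count _ l0 = 0)%N ?add0n.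
  by apply: sub_count => x /= /andP[].
apply/eqP; rewrite -leqn0 leqNgt -has_count; apply/hasPn => x xl /=.
by rewrite ltNge h ?mem_head// andbF.
Qed.

(** Since [l'] may contain customers simultaneous with [c], the count starts strictly earlier, or at
    0, when nobody arrives. *)
Lemma customers_suffix_ge m l0 c l' r : (m <= K)%N -> customers = l0 ++ c :: l' ->
  0 <= r <= T -> r < c.1 \/ r = 0 -> (class_count m l')%:R <= total m T - total m r.
Proof.
move=> mK E rT rc.
rewrite (total_arrivals_after T_ge0 counting_A)// ler_nat.
have trR : transitive (fun a b : R * nat => a.1 <= b.1).
  by move=> a b d; exact: le_trans.
have := customers_sorted K T A; rewrite {1}E sorted_pairwise// pairwise_cat /=.
move=> /and4P[_ _ /allP h _].
apply: (@leq_trans (count_after m r l')); last first.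
  by rewrite E /count_after count_cat /= addnA leq_addl.
rewrite /class_count /count_after; apply: eq_leq; apply: eq_in_count => x xl /=.
suff -> : r < x.1 by rewrite andbT.
case: rc => [rc|->]; first exact: lt_le_trans rc (h x xl).
have xc : x \in customers by rewrite E mem_cat inE xl !orbT.
by have [_ ? _] := customers_mem T_ge0 counting_A xc.
Qed.

Lemma customers_split (s : R) : customers =
  [seq c <- customers | c.1 <= s] ++ [seq c <- customers | s < c.1].
Proof.
have : sorted (fun a b : R * nat => a.1 <= b.1) customers by exact: customers_sorted.
elim: customers => [//|c l IH] /= cl.
have trR : transitive (fun a b : R * nat => a.1 <= b.1).
  by move=> a b d; exact: le_trans.
case: leP => cs /=; first by rewrite -IH// (path_sorted cl).
have /allP h := order_path_min trR cl.
rewrite (_ : [seq x <- l | x.1 <= s] = [::]) /=.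
  by congr cons; apply/esym/all_filterP/allP => x /h; exact: lt_le_trans.
apply/eqP; rewrite -(negbK (_ == _)) -has_filter; apply/hasPn => x /h cx.
by rewrite -ltNge; apply: lt_le_trans cx.
Qed.

(** * Threshold control on a path whose fluctuations are bounded by [B] *)

Variable B : R.
Hypothesis B_ge0 : 0 <= B.
Hypothesis deficit_le : forall k (s : R), (1 <= k <= K.-1)%N -> 0 <= s <= T ->
  beta k * (T - s) - (total k.+1 T - total k.+1 s) <= B.
Hypothesis excess_le : forall k (s : R), (1 <= k <= K.-1)%N -> 0 <= s <= T ->
  total k T - total k (previous_cell T s) - beta k * (T - s) <= B.
Hypothesis jump_le : forall s : R, 0 < s <= T ->
  exists2 r, 0 <= r < s & total K s - total K r <= B.

(** Common form of all cases in which the path meets its line: a nested rule up to elapsed time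
    [sigma], the [beta k] threshold afterwards. As [k0] is [k] or [k+1], the price [p k.+1]
    separates accepted from rejected classes in both phases. *)
Lemma threshold_regret (k k0 : nat) (sigma : R) :
  (1 <= k <= K.-1)%N -> (k <= k0 <= k.+1)%N -> 0 <= sigma <= T ->
  (forall c y, c \in customers -> c.1 <= sigma -> rule c.1 c.2 y = (c.2 <= k0)%N) ->
  (forall c y, c \in customers -> sigma < c.1 ->
     rule c.1 c.2 y = threshold_rule beta k (T - c.1) c.2 y) ->
  n%:R - total k0 sigma <= beta k * (T - sigma) ->
  beta k * (T - sigma) - B <= n%:R - total k0 sigma ->
  hindsight_revenue K p n T A - LT_revenue K p beta n T A <= p 1%N * (2 * B + 1).
Proof.
move=> k1K /andP[kk0 k0k] sT r1 r2 x1 x2.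
have [k1 kK'] := andP k1K.
have kK : (k.+1 <= K)%N by apply: leq_ltn_trans kK' _; rewrite prednK// (leq_trans _ K_gt2).
have kK0 := ltnW kK; have k0K := leq_trans k0k kK.
have q0 : 0 <= p k.+1 by apply: price_ge0.
have p10 : 0 <= p 1%N by apply: price_ge0; rewrite (leq_trans _ K_gt2).
have qp1 : p k.+1 <= p 1%N by apply: price_le.
apply: (@le_trans _ _ (p k.+1 * final + p 1%N * Num.max 0 (- final))).
  apply: regret_le => // c y cc; have [/andP[c1 cK] _ _] := customers_mem T_ge0 counting_A cc.
    case: (leP c.1 sigma) => cs; rewrite ?(r1 c y cc cs) ?(r2 c y cc cs).
      by move=> ck; apply: price_le => //; apply: leq_trans ck k0k.
    rewrite /threshold_rule => /orP[ck|/andP[/eqP->//]].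
    by apply: price_le => //; exact: leqW.
  case: (leP c.1 sigma) => cs; rewrite ?(r1 c y cc cs) ?(r2 c y cc cs).
    by rewrite -ltnNge => ck; apply: price_le => //; apply: leq_ltn_trans ck.
  by rewrite /threshold_rule negb_or -ltnNge => /andP[ck _]; apply: price_le.
have pT := previous_cell_ge0 T.
have pcT s : 0 <= s <= T -> 0 <= previous_cell T s <= T.
  by move=> /[dup] /previous_cell_le h /andP[_ h']; rewrite pT (le_trans h h').
have sE := customers_split sigma.
set l1 := [seq c <- _ | c.1 <= _] in sE; set l2 := [seq c <- _ | _ < c.1] in sE.
pose y := final_inventory rule l1 n%:Z.
have finalE : final = (final_inventory rule l2 y)%:~R.
  by rewrite /final {1}sE final_inventory_cat.
have yE : y%:~R = n%:R - total k0 sigma.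
  rewrite /y (@final_inventory_nested _ _ k0) => [|c z]; last first.
    by rewrite mem_filter => /andP[cs cc]; apply: r1.
  by rewrite /class_count count_filter (total_arrivalsE T_ge0 counting_A)// -pmulrn.
have l2E m : (m <= K)%N -> (class_count m l2)%:R = total m T - total m sigma.
  by move=> mK; rewrite (total_arrivals_after T_ge0 counting_A)// /class_count count_filter.
have thr c z : c \in l2 -> rule c.1 c.2 z =
    (c.2 <= k)%N || ((c.2 == k.+1) && (beta k * (T - c.1) <= z%:~R)).
  by rewrite mem_filter => /andP[cs cc]; apply: r2.
have suf l0 c l' : l2 = l0 ++ c :: l' ->
    customers = (l1 ++ l0) ++ c :: l' /\ 0 <= c.1 <= T.
  move=> e; have E : customers = (l1 ++ l0) ++ c :: l' by rewrite -catA -e.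
  split=> //; have [_ c0 ->] : [/\ (1 <= c.2 <= K)%N, 0 < c.1 & c.1 <= T].
    by apply: (customers_mem T_ge0 counting_A); rewrite E mem_cat mem_head orbT.
  by rewrite ltW.
have F1 : final <= B.
  rewrite finalE; apply: (final_inventory_le thr).
    move=> l0 c l' /suf[E cT].
    have := customers_suffix_le kK E; have := deficit_le k1K cT; lra.
  rewrite yE l2E//; have := deficit_le k1K sT; lra.
(* The start at [sigma] costs at most [2 * B], namely the undershoot there plus the later excess; a
   later class-[k+1] acceptance costs at most [B + 1]. *)
have F2 : - (2 * B + 1) <= final.
  rewrite finalE; apply: (final_inventory_ge thr).
    move=> l0 c l' /suf[E cT].
    have := customers_suffix_ge kK0 E (pcT _ cT) (previous_cell_lt cT).
    have := excess_le k1K cT; have := B_ge0; lra.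
  rewrite yE l2E//; have := excess_le k1K sT.
  have [s0 s1] := andP sT.
  have := total_arrivals_le counting_A kK0 (pT sigma) (previous_cell_le sT) s1.
  have := B_ge0; lra.
case: (leP 0 final) => f0.
  rewrite max_l ?oppr_le0// mulr0 addr0.
  apply: le_trans (ler_wpM2r f0 qp1) _; rewrite ler_wpM2l//; have := B_ge0; lra.
have -> : Num.max 0 (- final) = - final by rewrite max_r// oppr_ge0 ltW.
apply: (@le_trans _ _ (p 1%N * - final)); last by rewrite ler_wpM2l//; lra.
by rewrite gerDr mulr_ge0_le0// ltW.
Qed.

(** Right continuity in elapsed time means that, in remaining time, the path is constant just below
    the supremum. With the path value frozen, closedness of [Q] under approach from below puts the
    supremum in the set. *)
Lemma stop_attained (k : nat) (Q : R -> R -> Prop) : (k <= K)%N ->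
  (forall x t, (forall e, 0 < e -> exists2 u, t - e < u <= t & Q x u) -> Q x t) ->
  let E := [set t : R | 0 <= t <= T /\ Q (nested_path n T A k t) t] in
  E !=set0 ->
  [/\ 0 <= sup E <= T, Q (nested_path n T A k (sup E)) (sup E) &
      forall t, sup E < t <= T -> ~ Q (nested_path n T A k t) t].
Proof.
move=> kK Qcl E E0.
have ubE : ubound E T by move=> t [/andP[]].
have supE : has_sup E by split=> //; exists T.
have sT : 0 <= sup E <= T.
  case: (E0) => t Et; have [/andP[t0 _] _] := Et.
  rewrite ge_sup// andbT; apply: le_trans t0 _; exact: (ub_le_sup supE.2 Et).
have [s0 s1] := andP sT.
split => // [|t /andP[st tT] Qt]; last first.
  have : E t by split => //; rewrite (le_trans s0 (ltW st)) tT.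
  by move=> /(ub_le_sup supE.2); rewrite leNgt st.
apply: Qcl => e e0.
have Ts : 0 <= T - sup E by rewrite subr_ge0.
have [e' e'0 he'] := total_arrivals_right_constant counting_A kK Ts.
have m0 : 0 < Num.min e e' by rewrite lt_min e0.
have [u [/andP[u0 uT] Qu] su] := sup_adherent m0 supE.
have us : u <= sup E by apply: (ub_le_sup supE.2); split; rewrite ?u0.
have [h1 h2] : sup E - e < u /\ sup E - e' < u.
  by split; apply: le_lt_trans su; rewrite lerD2l lerN2 ge_min lexx ?orbT.
exists u; first by rewrite h1 us.
move: Qu; rewrite /nested_path /arrivals_until -!/(total_arrivals A _ _) he'//; lra.
Qed.

Hypothesis beta_gt0 : forall k, (1 <= k <= K.-1)%N -> 0 < beta k.
Hypothesis beta_le : forall k, (1 <= k)%N -> (k.+1 <= K.-1)%N -> beta k <= beta k.+1.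

Notation path_at := (nested_path n T A).

Let elapsed_lt (t s : R) : (T - s < t) = (T - t < s).
Proof. by rewrite ltrBlDr addrC -ltrBlDr. Qed.

Lemma path_at_mono k s t : (k <= K)%N -> 0 <= s -> s <= t -> t <= T ->
  path_at k s <= path_at k t.
Proof.
move=> kK s0 st tT; rewrite /nested_path /arrivals_until -!/(total_arrivals A _ _).
rewrite lerD2l lerN2; apply: (total_arrivals_le counting_A) => //; lra.
Qed.

(** Bounds the overshoot below a line. At some earlier elapsed time [r] the path was still on or
    above the line, which was no lower then, and at most [B] customers arrived since. *)
Lemma le_path_at_stop (b : R) k t : (k <= K)%N -> 0 <= b -> 0 <= t -> t < T ->
  (forall u, t < u <= T -> b * u <= path_at k u) -> b * t - B <= path_at k t.
Proof.
move=> kK b0 t0 tT h.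
have sT : 0 < T - t <= T by apply/andP; split; lra.
have [r /andP[r0 rs]] := jump_le sT.
have r1 : r <= T - t by exact: ltW.
have sT1 : T - t <= T by lra.
have := total_arrivals_mono counting_A kK (leqnn K) r0 r1 sT1.
have uT : t < T - r <= T by apply/andP; split; lra.
have := h _ uT; rewrite /nested_path /arrivals_until -!/(total_arrivals A _ _) subKr.
have : b * t <= b * (T - r) by rewrite ler_wpM2l//; lra.
by lra.
Qed.

(** No overshoot is possible upwards: inventory only falls, so a path above the line at [t] was
    already above it slightly earlier. *)
Lemma path_at_stop_le (b : R) k t : (k <= K)%N -> 0 < b -> 0 <= t -> t < T ->
  (forall u, t < u <= T -> path_at k u <= b * u) -> path_at k t <= b * t.
Proof.
move=> kK b0 t0 tT h; rewrite leNgt; apply/negP => xt.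
(* The line reaches height [x] at [x / b]; before that point, and after [t], it is still below
   [x]. *)
pose x := path_at k t; pose u := Num.min T ((t + x / b) / 2).
have tx : t < x / b by rewrite ltr_pdivlMr// mulrC.
have tu : t < u <= T by rewrite lt_min tT ge_min lexx /= andbT ltr_pdivlMr//; lra.
have /andP[/ltW tu1 uT] := tu.
have xu : x <= b * u by apply: le_trans (h u tu); apply: path_at_mono.
have : b * u <= b * ((t + x / b) / 2) by rewrite ler_pM2l// ge_min lexx orbT.
have -> : b * ((t + x / b) / 2) = (b * t + x) / 2 by field; lra.
have xt' : b * t < x by [].
by lra.
Qed.

Let p1_ge0 : 0 <= p 1%N.
Proof. by apply: price_ge0; rewrite (leq_trans _ K_gt2). Qed.

Let final_nested k : (k <= K)%N ->
  (forall c y, c \in customers -> rule c.1 c.2 y = (c.2 <= k)%N) ->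
  final = path_at k 0.
Proof.
move=> kK h; rewrite /final (final_inventory_nested _ h) -pmulrn; congr (_ - _).
rewrite /arrivals_until subr0 -/(total_arrivals A k T).
rewrite (total_arrivalsE T_ge0 counting_A) ?T_ge0 ?lexx//; congr (_%:R).
apply: eq_in_count => c /(customers_mem T_ge0 counting_A)[_ _ ->].
by rewrite andbT.
Qed.

Let path_at_start k : (k <= K)%N -> path_at k T = n%:R.
Proof.
move=> kK; rewrite /nested_path /arrivals_until -/(total_arrivals A k _) subrr.
by rewrite (total_arrivals0 counting_A)// subr0.
Qed.

(** For low or high inventory when the line is never met: the nested rule lasts to the end and a
    suitable [q] makes the regret nonpositive. *)
Lemma no_hit_regret k (q : R) : (k <= K)%N -> 0 <= q ->
  (forall c y, c \in customers -> rule c.1 c.2 y = (c.2 <= k)%N) ->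
  (forall j, (1 <= j <= k)%N -> q <= p j) ->
  (forall j, (k < j <= K)%N -> p j <= q) ->
  q * path_at k 0 + p 1%N * Num.max 0 (- path_at k 0) <= 0 ->
  hindsight_revenue K p n T A - LT_revenue K p beta n T A <= p 1%N * (2 * B + 1).
Proof.
move=> kK q0 h ha hr; rewrite -(final_nested kK h) => F0.
apply: (@le_trans _ _ 0); last by rewrite mulr_ge0//; have := B_ge0; lra.
apply: le_trans F0; apply: regret_le => // c y cc;
  have [/andP[c1 cK] _ _] := customers_mem T_ge0 counting_A cc; rewrite h// => ck.
  by apply: ha; rewrite c1.
by apply: hr; rewrite cK ltnNge ck.
Qed.

(** * The three ranges of the initial ratio *)

Lemma low_regret : n%:R / T < beta 1%N ->
  hindsight_revenue K p n T A - LT_revenue K p beta n T A <= p 1%N * (2 * B + 1).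
Proof.
move=> a1.
have k1K : (1 <= 1 <= K.-1)%N by case: (K) K_gt2 => [|[|[|]]].
have b0 := beta_gt0 k1K.
have oneK : (1 <= K)%N by rewrite (leq_trans _ K_gt2).
have nT : n%:R < beta 1%N * T by rewrite -ltr_pdivrMr.
have ruleE s j y : rule s j y = if T - stop_low beta n T A < s
    then threshold_rule beta 1 (T - s) j y else j == 1%N.
  by rewrite /rule /LT_accepts a1 elapsed_lt.
have le1 j : (1 <= j)%N -> (j == 1%N) = (j <= 1)%N by case: j => [|[|]].
case: (pselect ([set t : R | 0 <= t <= T /\ path_at 1 t = beta 1%N * t] !=set0)) => E0.
  have [|sT Qs _] := stop_attained (Q := fun x t => x = beta 1%N * t) oneK _ E0.
    move=> x t hx; apply/eqP; rewrite eq_le; apply/andP; split.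
      by have [u /andP[_ ut] ->] := hx 1 ltr01; rewrite ler_pM2l.
    apply/ler_addgt0Pr => e e0; have [|u /andP[ut _] ->] := hx (e / beta 1%N).
      by rewrite divr_gt0.
    have : beta 1%N * (t - e / beta 1%N) <= beta 1%N * u by rewrite ler_pM2l// ltW.
    by rewrite mulrBr mulrCA divff ?gt_eqF// mulr1; lra.
  rewrite -/(stop_low beta n T A) in sT Qs.
  have [s0 s1] := andP sT.
  apply: (@threshold_regret 1 1 (T - stop_low beta n T A)) => //.
  - by apply/andP; split; lra.
  - move=> c y cc cs; rewrite ruleE ltNge cs /=; apply: le1.
    by have [/andP[]] := customers_mem T_ge0 counting_A cc.
  - by move=> c y cc cs; rewrite ruleE cs.
  - by rewrite subKr -Qs.
  - by rewrite subKr -Qs gerBl.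
(* The supremum of the empty set is 0, so the initial rule applies to every customer. *)
have s0 : stop_low beta n T A = 0.
  by rewrite /stop_low (_ : [set t | _] = set0) ?sup0//; apply/eqP/negPn/negP => /set0P.
(* Otherwise the path, starting below the line, ends above it. At the first elapsed time when it is
   on or above the line it lies exactly on it, since it cannot jump upwards, contradicting the
   absence of a hit. *)
have X0 : path_at 1 0 <= 0.
  rewrite leNgt; apply/negP => X0.
  pose E := [set t : R | 0 <= t <= T /\ beta 1%N * t <= path_at 1 t].
  have [| |sT Qs hs] := stop_attained (Q := fun x t => beta 1%N * t <= x) oneK.
  - move=> x t hx; apply/ler_addgt0Pr => e e0; have [|u /andP[ut _] ux] := hx (e / beta 1%N).
      by rewrite divr_gt0.
    have : beta 1%N * (t - e / beta 1%N) <= beta 1%N * u by rewrite ler_pM2l// ltW.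
    by rewrite mulrBr mulrCA divff ?gt_eqF// mulr1; lra.
  - by exists 0; split; [rewrite lexx T_ge0|rewrite mulr0 ltW].
  set tau := sup _ in sT Qs hs; have [t0 tT] := andP sT.
  have tT' : tau < T.
    rewrite lt_neqAle tT andbT; apply/eqP => tE.
    by move: Qs; rewrite tE path_at_start// leNgt nT.
  apply: E0; exists tau; split => //; apply/eqP; rewrite eq_le Qs andbT.
  by apply: path_at_stop_le => // u /hs /negP; rewrite -ltNge => /ltW.
apply: (@no_hit_regret 1 (p 1%N)) => //.
- move=> c y cc; have [/andP[c1 _] _ cT] := customers_mem T_ge0 counting_A cc.
  by rewrite ruleE s0 subr0 ltNge cT /=; apply: le1.
- by move=> j /andP[j1 j2]; rewrite (_ : j = 1%N)//; apply/eqP; rewrite eqn_leq j2.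
- by move=> j /andP[j1 jK]; apply: price_le => //; exact: ltnW.
- by rewrite max_r ?oppr_ge0//; lra.
Qed.

Lemma high_regret : beta K.-1 < n%:R / T ->
  hindsight_revenue K p n T A - LT_revenue K p beta n T A <= p 1%N * (2 * B + 1).
Proof.
move=> aK.
have K0 : (0 < K)%N by rewrite (leq_trans _ K_gt2).
have kK : (1 <= K.-1 <= K.-1)%N by rewrite leqnn andbT; case: (K) K_gt2 => [|[|[|]]].
have b0 := beta_gt0 kK.
have nT : beta K.-1 * T < n%:R by rewrite -ltr_pdivlMr.
have beta1K k : (1 <= k)%N -> (k <= K.-1)%N -> beta 1%N <= beta k.
  elim: k => // -[|k] IH //= _ kK'; apply: le_trans (IH isT (ltnW kK')) _.
  exact: beta_le.
have a1 : (n%:R / T < beta 1%N) = false.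
  by apply/negbTE; rewrite -leNgt; apply: le_trans (ltW aK); apply: beta1K; case/andP: kK.
have ruleE s j y : rule s j y = if T - stop_high K beta n T A < s
    then threshold_rule beta K.-1 (T - s) j y else true.
  by rewrite /rule /LT_accepts a1 aK elapsed_lt.
case: (pselect ([set t : R | 0 <= t <= T /\ path_at K t <= beta K.-1 * t] !=set0)) => E0.
  have [//| |sT Qs hs] := stop_attained (Q := fun x t => x <= beta K.-1 * t) _ _ E0.
    move=> x t /(_ 1 ltr01)[u /andP[_ ut] xu].
    by apply: le_trans xu _; rewrite ler_pM2l.
  rewrite -/(stop_high K beta n T A) in sT Qs hs.
  have [s0 s1] := andP sT.
  apply: (@threshold_regret K.-1 K (T - stop_high K beta n T A)) => //.
  - by rewrite prednK// leq_pred leqnn.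
  - by apply/andP; split; lra.
  - move=> c y cc cs; rewrite ruleE ltNge cs /=.
    by have [/andP[_ ->]] := customers_mem T_ge0 counting_A cc.
  - by move=> c y cc cs; rewrite ruleE cs.
  - by rewrite subKr.
  - rewrite subKr; apply: le_path_at_stop => //; first exact: ltW.
      rewrite lt_neqAle s1 andbT; apply/eqP => tE.
      by move: Qs; rewrite tE path_at_start// leNgt nT.
    by move=> u /hs /negP; rewrite -ltNge => /ltW.
have s0 : stop_high K beta n T A = 0.
  by rewrite /stop_high (_ : [set t | _] = set0) ?sup0//; apply/eqP/negPn/negP => /set0P.
(* A negative final value would itself be a hit at remaining time 0. *)
have X0 : 0 <= path_at K 0.
  rewrite leNgt; apply/negP => X0; apply: E0; exists 0; split.
    by rewrite lexx T_ge0.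
  by rewrite mulr0 ltW.
apply: (@no_hit_regret K 0) => //.
- move=> c y cc; have [/andP[_ ->] _ cT] := customers_mem T_ge0 counting_A cc.
  by rewrite ruleE s0 subr0 ltNge cT.
- by move=> j; apply: price_ge0.
- by move=> j /andP[/leq_trans h /h]; rewrite ltnn.
- by rewrite max_l ?oppr_le0//; lra.
Qed.

Lemma middle_regret : beta 1%N <= n%:R / T -> n%:R / T <= beta K.-1 ->
  hindsight_revenue K p n T A - LT_revenue K p beta n T A <= p 1%N * (2 * B + 1).
Proof.
move=> a1 aK.
pose alpha : R := n%:R / T.
have K0 : (0 < K)%N by rewrite (leq_trans _ K_gt2).
have K1 : (1 < K.-1)%N by case: (K) K_gt2 => [|[|[|]]].
pose P (k : 'I_K) := (1 < k)%N && (beta k.-1 <= alpha <= beta k).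
case pk : [pick k | P k] => [k|]; last first.
  (* The least [k > 1] with [alpha <= beta k] qualifies: its predecessor is 1, where
     [beta 1 <= alpha] is assumed, or fails the upper bound by minimality. *)
  exfalso; move: pk; case: pickP => // no _.
  have ex : exists k, (1 < k)%N && (alpha <= beta k) by exists K.-1; rewrite K1.
  case: (ex_minnP ex) => m /andP[m1 am] mmin.
  have mK : (m < K)%N by rewrite -[ltnRHS]prednK// ltnS; apply: mmin; rewrite K1.
  have := no (Ordinal mK); rewrite /P /= m1 am andbT /=.
  move=> /negbT; rewrite -ltNge => am'.
  case: m m1 am mmin mK am' => [//|m] /=; rewrite ltnS leq_eqVlt => /predU1P[<-|m1] am mmin mK am'.
    by move: am'; rewrite ltNge a1.
  by have := mmin m; rewrite m1 (ltW am') => /(_ isT); rewrite ltnn.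
have /and3P[k1 ak1 ak] : P k by move: pk; case: pickP => // k' Pk' [<-].
have kK := ltn_ord k.
set tau := stop_middle beta n T A k.
have ruleE s j y : rule s j y =
    if T - tau < s then
      if path_at k tau <= beta k.-1 * tau
      then threshold_rule beta k.-1 (T - s) j y
      else threshold_rule beta k (T - s) j y
    else (j <= k)%N.
  by rewrite /rule /LT_accepts ltNge a1 /= ltNge aK /= -/alpha -/(P _) pk elapsed_lt.
have kK' : (1 <= k <= K.-1)%N by rewrite (ltnW k1) -ltnS prednK.
have kK1 : (1 <= k.-1 <= K.-1)%N.
  have [_ h] := andP kK'; rewrite (leq_trans (leq_pred _) h) andbT.
  by case: (nat_of_ord k) k1 => [|[|]].
have [b0 b1] := (beta_gt0 kK', beta_gt0 kK1).
have nT1 : beta k.-1 * T <= n%:R by rewrite -ler_pdivlMr.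
have nT2 : n%:R <= beta k * T by rewrite -ler_pdivrMr.
have [||sT Qs hs] := @stop_attained k
    (fun x t => ~ (beta k.-1 * t < x < beta k * t)) (ltnW kK).
- move=> x t hx /andP[tx xt].
  have [|u /andP[ut tu] Qu] := hx ((beta k * t - x) / beta k).
    by rewrite divr_gt0// subr_gt0.
  apply: Qu; apply/andP; split; first by apply: le_lt_trans tx; rewrite ler_pM2l.
  have : beta k * (t - (beta k * t - x) / beta k) < beta k * u by rewrite ltr_pM2l.
  by rewrite mulrBr mulrCA divff ?gt_eqF// mulr1; lra.
(* The strip between the lines is empty at remaining time 0, so the path always exits. *)
- by exists 0; split; [rewrite lexx T_ge0|rewrite !mulr0 => /andP[/lt_trans h /h]; rewrite ltxx].
rewrite -/(stop_middle beta n T A k) -/tau in sT Qs hs.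
have [s0 s1] := andP sT.
have hs' u : tau < u <= T -> beta k.-1 * u < path_at k u < beta k * u.
  by move=> /hs /contrapT.
have sT' : 0 <= T - tau <= T by apply/andP; split; lra.
have r1 c y : c \in customers -> c.1 <= T - tau -> rule c.1 c.2 y = (c.2 <= k)%N.
  by move=> _ cs; rewrite ruleE ltNge cs.
have sE : n%:R - total k (T - tau) = path_at k tau by [].
(* Stopping at once occurs when [alpha] equals an endpoint; the bounds on [n] then replace the
   overshoot lemmas. *)
have tau_cases : tau = T \/ tau < T by case: (ltgtP tau T) s1; [right| |left].
(* A lower exit leads to the [k-1] threshold after accepting one class more, with overshoot at most
   [B]; an upper exit leads to the [k] threshold with the path exactly on its line. *)
case: (leP (path_at k tau) (beta k.-1 * tau)) => xt.
  apply: (@threshold_regret k.-1 k (T - tau)) => //.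
  - by rewrite prednK ?leq_pred ?leqnn// ltnW.
  - by move=> c y _ cs; rewrite ruleE cs xt.
  - by rewrite subKr.
  - rewrite subKr sE; case: tau_cases => [tE|tT].
      by rewrite tE path_at_start ?(ltnW kK)//; have := B_ge0; lra.
    apply: le_path_at_stop => //; [exact: ltnW|exact: ltW|].
    by move=> u /hs' /andP[/ltW].
apply: (@threshold_regret k k (T - tau)) => //.
- by rewrite leqnn leqnSn.
- by move=> c y _ cs; rewrite ruleE cs leNgt xt.
- rewrite subKr sE; case: tau_cases => [tE|tT].
    by rewrite tE path_at_start ?(ltnW kK).
  apply: path_at_stop_le => //; first exact: ltnW.
  by move=> u /hs' /andP[_ /ltW].
- rewrite subKr sE lerBlDr; apply: ler_wpDr => //.
  by rewrite leNgt; apply/negP => xt'; apply: Qs; rewrite xt.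
Qed.

Lemma pathwise_regret_le :
  hindsight_revenue K p n T A - LT_revenue K p beta n T A <= p 1%N * (2 * B + 1).
Proof.
case: (ltP (n%:R / T) (beta 1%N)) => [|a1]; first exact: low_regret.
case: (ltP (beta K.-1) (n%:R / T)) => [|aK]; first exact: high_regret.
exact: middle_regret.
Qed.

End PathwiseRegret.

(** * Averaging the pathwise bound *)

Unset Implicit Arguments.

Theorem mainTheorem2 (R : realType) (K : nat) (lambda p beta : nat -> R)
  (hK : (2 < K)%N)
  (hlambda : forall j : nat, (1 <= j <= K)%N -> 0 < lambda j)
  (hp_decr : forall i j : nat, (1 <= i)%N -> (i < j)%N -> (j <= K)%N -> p j < p i)
  (hp_pos : 0 < p K)
  (hbeta : forall j : nat, (1 <= j <= K.-1)%N ->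
     \sum_(1 <= i < j.+1) lambda i < beta j
     /\ beta j < \sum_(1 <= i < j.+2) lambda i) :
  exists C : R,
    forall (d : measure_display) (Omega : measurableType d)
           (P : probability Omega R) (A : nat -> R -> Omega -> nat),
      independent_poisson_arrivals P K lambda A ->
      forall (n : nat) (T : R), 0 < T ->
        (LT_regret P K p beta A n T <= C%:E)%E.
Proof.
have K1 : (1 < K)%N by apply: ltnW.
have [C HC] := uniform_path_bounds hlambda hbeta K1.
have p10 : 0 <= p 1%N by apply: (price_ge0 hp_decr hp_pos); rewrite /= ltnW.
have beta_gt0 k : (1 <= k <= K.-1)%N -> 0 < beta k.
  move=> /[dup] /andP[_ kK] /hbeta[h _]; apply: le_lt_trans h.
  rewrite big_nat_cond sumr_ge0// => j; rewrite andbT ltnS => /andP[j1 jk].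
  by rewrite ltW// hlambda// j1 (leq_trans jk)// (leq_trans kK)// leq_pred.
have beta_le k : (1 <= k)%N -> (k.+1 <= K.-1)%N -> beta k <= beta k.+1.
  move=> k1 kK; have [_ h1] := hbeta k (introT andP (conj k1 (ltnW kK))).
  have [h2 _] := hbeta k.+1 kK.
  exact: ltW (lt_trans h1 h2).
(* The pathwise bound is affine in [f w], so a mean at most [C] for [f] yields this constant. *)
exists (p 1%N * (2 * C + 1)) => d Omega P A [HA _] n T T0.
have [f fC Hf] := HC _ _ P A HA T T0.
apply: (@expectation_le_dominated _ _ _ _ _ (fun w => p 1%N * (2 * f w + 1))).
  apply: mean_leZ => //; apply: mean_leD; last exact: mean_le_cst.
  exact: mean_leZ.
move=> w; have [HU HL HJ] := Hf w.
have f0 : 0 <= f w by have [_ h _] := fC.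
have cA j : (1 <= j <= K)%N -> counting_path (fun s => A j s w).
  by move=> jK; apply: (poisson_counting_path w (HA j jK)).
exact: (pathwise_regret_le n hK hp_decr hp_pos T0 cA f0 HU HL HJ beta_gt0 beta_le).
Qed.
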